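(* For every $\rho>0$ and $d\ge1$ there is a positive constant $C_{\rho,d}$ depending only on $\rho$ and $d$ such that the following holds for every $1\le s\le d$, $V>0$, $\sigma>0$. Suppose the design points form a lattice $$\{x^{(1)},\dots,x^{(n)}\}=\prod_{k=1}^d\big\{u^{(k)}_{i_k}:\ i_k\in\{0,1,\dots,n_k-1\}\big\},\qquad n=n_1\cdots n_d,$$ where for every $k\in[d]$, $n_k\ge2$, $0=u^{(k)}_0<u^{(k)}_1<\dots<u^{(k)}_{n_k-1}\le1$, and $u^{(k)}_{i_k}-u^{(k)}_{i_k-1}\ge\rho/n_k$ for all $i_k\in\{1,\dots,n_k-1\}$. Suppose $y_i=f^*(x^{(i)})+\xi_i$ for $i\in[n]$, where $\xi_1,\dots,\xi_n$ are independent mean-zero sub-Gaussian errors with parameter $\sigma$, i.e. $\mathbb{E}[e^{\lambda\xi_i}]\le e^{\sigma^2\lambda^2/2}$ for all $\lambda\in\mathbb{R}$. If $f^*\in\mathcal{F}^{d,s}_{\infty\text{-mars}}$ and $V_{\text{mars}}(f^* )\le V$, then the estimator $$\hat f^{d,s}_{n,V}\in\underset{f}{\operatorname{argmin}}\Big\{\sum_{i=1}^n\big(y_i-f(x^{(i)})\big)^2:\ f\in\mathcal{F}^{d,s}_{\infty\text{-mars}},\ V_{\text{mars}}(f)\le V\Big\}$$ satisfies $$\mathcal{R}_F\big(\hat f^{d,s}_{n,V},f^*\big)\le C_{\rho,d}\Big(\frac{\sigma^2V^{1/2}}{n}\Big)^{4/5}\Big[\log\Big(2+\frac{Vn^{1/2}}{\sigma}\Big)\Big]^{\frac{3(2s-1)}{5}}+C_{\rho,d}\frac{\sigma^2}{n}[\log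 n]^2 .$$
   Context: $[m]=\{1,\dots,m\}$, $u_+=\max\{u,0\}$, $\mathbf 0=(0,\dots,0)$. The risk is $\mathcal{R}_F(\hat f_n,f^* )=\mathbb{E}\big[\frac1n\sum_{i=1}^n(\hat f_n(x^{(i)})-f^*(x^{(i)}))^2\big]$, the expectation being over $y_1,\dots,y_n$. For $\alpha\in\{0,1\}^d$ put $S(\alpha)=\{j\in[d]:\alpha_j=1\}$ and $|\alpha|=|S(\alpha)|$; $t^{(\alpha)}=(t_j,\ j\in S(\alpha))$. For $a_{\mathbf 0}\in\mathbb{R}$ and a collection $\{\nu_\alpha\}$ in which, for each $\alpha\in\{0,1\}^d\setminus\{\mathbf 0\}$ with $|\alpha|\le s$, $\nu_\alpha$ is a finite (Borel) signed measure on $[0,1)^{|\alpha|}$ (coordinates indexed by $S(\alpha)$), define on $[0,1]^d$ $$f_{a_{\mathbf 0},\{\nu_\alpha\}}(x_1,\dots,x_d)=a_{\mathbf 0}+\sum_{\substack{\alpha\in\{0,1\}^d\setminus\{\mathbf 0\}\\|\alpha|\le s}}\int_{[0,1)^{|\alpha|}}\prod_{j\in S(\alpha)}(x_j-t_j)_+\,d\nu_\alpha(t^{(\alpha)}).$$ $\mathcal{F}^{d,s}_{\infty\text{-mars}}$ is the class of all such functions. The complexity of $f=f_{a_{\mathbf 0},\{\nu_\alpha\}}$ is $$V_{\text{mars}}(f)=\sum_{\substack{\alpha\in\{0,1\}^d\setminus\{\mathbf 0\}\\|\alpha|\le s}}|\nu_\alpha|\big([0,1)^{|\alpha|}\setminus\{\mathbf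 0\}\big),$$ where $|\nu|$ is the (total) variation measure of $\nu$; this is well defined because $a_{\mathbf 0}$ and the $\nu_\alpha$ are uniquely determined by $f$. (A minimizer $\hat f^{d,s}_{n,V}$ exists, and all minimizers agree at the design points.) *)

(* Defs.v *)
From HB Require Import structures.
From mathcomp Require Import all_boot all_order all_algebra.
From mathcomp Require Import all_classical all_reals all_analysis.

Set Implicit Arguments.
Unset Strict Implicit.
Unset Printing Implicit Defensive.

Import Order.TTheory GRing.Theory Num.Theory.
Import numFieldNormedType.Exports.

Local Open Scope classical_set_scope.
Local Open Scope ring_scope.

Section SignedMeasure.
Context (disp : measure_display) (T : measurableType disp) (R : realType).
Variable nu : {charge set T -> \bar R}.

(* The library states Jordan decompositions relative to a given Hahn
   decomposition; one is chosen here.  The values below at measurable sets do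
   not depend on the choice. *)
Definition hahn_pos : set T := projT1 (cid (Hahn_decomposition nu)).

Definition hahn_neg : set T :=
  projT1 (cid (projT2 (cid (Hahn_decomposition nu)))).

Lemma hahn_posnegP : hahn_decomposition nu hahn_pos hahn_neg.
Proof. exact: projT2 (cid (projT2 (cid (Hahn_decomposition nu)))). Qed.

Definition charge_total_variation (A : set T) : \bar R :=
  charge_variation hahn_posnegP A.

Definition charge_integral (D : set T) (f : T -> R) : R :=
  (\int[jordan_pos hahn_posnegP]_(t in D) f t)
  - (\int[jordan_neg hahn_posnegP]_(t in D) f t).

End SignedMeasure.

Section Mars.
Variables (R : realType) (d : nat).

Definition cube : set (d.-tuple R) := [set x | forall j, 0 <= tnth x j <= 1].

Definition hocube (k : nat) : set (k.-tuple R) :=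
  [set t | forall i, 0 <= tnth t i < 1].

Definition zero_tuple (k : nat) : k.-tuple R := [tuple 0 | _ < k].

(* alpha in {0,1}^d is represented by its support S(alpha) : {set 'I_d}, and
   t^(alpha) by a tuple whose i-th entry is the coordinate indexed by the i-th
   element enum_val i of S(alpha).  A signed measure on [0,1)^|alpha| is given
   as a charge on R^|alpha|, of which only the restriction to [0,1)^|alpha| is
   ever used. *)
Definition signed_measures : Type :=
  forall alpha : {set 'I_d}, {charge set (#|alpha|.-tuple R) -> \bar R}.

Definition mars_index (s : nat) (alpha : {set 'I_d}) : bool :=
  (alpha != finset.set0) && (#|alpha| <= s)%N.

Definition mars_fun (s : nat) (a0 : R) (nu : signed_measures)
    (x : d.-tuple R) : R :=
  a0 + \sum_(alpha : {set 'I_d} | mars_index s alpha)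
         charge_integral (nu alpha) (@hocube #|alpha|)
           (fun t => \prod_(i < #|alpha|)
                       Num.max (tnth x (enum_val i) - tnth t i) 0).

Definition mars_variation (s : nat) (nu : signed_measures) : \bar R :=
  (\sum_(alpha : {set 'I_d} | mars_index s alpha)
     charge_total_variation (nu alpha)
       (@hocube #|alpha| `\` [set zero_tuple #|alpha|]))%E.

(* Members of the class are functions on [0,1]^d: values of f outside the cube
   are irrelevant. *)
Definition mars_represents (s : nat) (f : d.-tuple R -> R)
    (a0 : R) (nu : signed_measures) : Prop :=
  forall x, cube x -> f x = mars_fun s a0 nu x.

Definition mars_class (s : nat) : set (d.-tuple R -> R) :=
  [set f | exists a0 nu, mars_represents s f a0 nu].

(* For f in mars_class s this is the complexity of f: by uniqueness of the
   representation, the set below is then a singleton.  The value 0 is returned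
   outside of the class. *)
Definition Vmars (s : nat) (f : d.-tuple R -> R) : \bar R :=
  xget 0%E [set v | exists a0 nu,
    mars_represents s f a0 nu /\ v = mars_variation s nu].

Definition is_mars_estimator (s n : nat) (V : R) (x : 'I_n -> d.-tuple R)
    (y : 'I_n -> R) (f : d.-tuple R -> R) : Prop :=
  [/\ mars_class s f, (Vmars s f <= V%:E)%E
    & forall g, mars_class s g -> (Vmars s g <= V%:E)%E ->
        \sum_(i < n) (y i - f (x i)) ^+ 2 <= \sum_(i < n) (y i - g (x i)) ^+ 2].

Definition lattice_design (rho : R) (n : nat) (N : 'I_d -> nat)
    (u : 'I_d -> nat -> R) (x : 'I_n -> d.-tuple R) : Prop :=
  [/\ n = (\prod_(k < d) N k)%N,
      range x = [set p | forall k, exists2 i, (i < N k)%N & tnth p k = u k i]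
    & forall k,
      [/\ (2 <= N k)%N, u k 0%N = 0,
          forall i, (i.+1 < N k)%N -> u k i < u k i.+1,
          u k (N k).-1 <= 1
        & forall i, (i.+1 < N k)%N -> rho / (N k)%:R <= u k i.+1 - u k i]].

End Mars.

Section Noise.
Context (disp : measure_display) (T : measurableType disp) (R : realType).
Variable P : probability T R.

Definition mutually_independent (n : nat) (X : 'I_n -> {RV P >-> R}) : Prop :=
  forall (J : {set 'I_n}) (A : 'I_n -> set R),
    (forall i, measurable (A i)) ->
    P (\bigcap_(i in [set` J]) (X i @^-1` A i))
    = (\prod_(i in J) P (X i @^-1` A i))%E.

Definition sub_gaussian (sigma : R) (X : {RV P >-> R}) : Prop :=
  forall lambda : R,
    ('E_P[fun w => expR (lambda * X w)%R]
      <= (expR (sigma ^+ 2 * lambda ^+ 2 / 2))%:E)%E.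

Definition risk (d n : nat) (x : 'I_n -> d.-tuple R)
    (fhat : T -> d.-tuple R -> R) (fstar : d.-tuple R -> R) : \bar R :=
  ('E_P[fun w =>
     (n%:R^-1 * \sum_(i < n) (fhat w (x i) - fstar (x i)) ^+ 2)%R])%E.

End Noise.

(* Main.v *)
(* For a lattice design the error vector D of the estimator satisfies
   |D|^2 <= 2 <xi, D>, so it suffices to bound the noise functional on the
   class.  Expanding each factor (x - t)_+ in the Faber (hierarchical hat)
   basis with respect to t, and tensorising, writes every atom
   prod_k (x_k - t_k)_+, restricted to the design, as a combination of vectors
   B_j organised in levels: level m has O(m^(s-1) 2^m) vectors of squared norm
   O(n 2^-m), and they carry coefficients of total size O(m^(s-1) 2^-m).
   Let p be the orthogonal projection onto the span of the levels <= M.  In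
   units of sigma^2 / n, and with T = V sqrt(n) / sigma, the part <p xi, D> costs
   the dimension 2^M M^(s-1).  The functional (1 - p) xi vanishes on the atoms
   with t = 0, whose mass is unconstrained, and on the others it is at most a
   sum over the levels m > M of maxima of finitely many sub-Gaussian variables,
   which costs T M^(s-1/2) 2^(-3M/2).  Choosing 2^M of order T^(2/5) gives
   T^(2/5) (log T)^(s-1/2), and s - 1/2 <= 3(2s-1)/5.  If T < 1, one takes
   M = 0 and the bounded dimension is absorbed by (log n)^2. *)

Require Import Defs.
From HB Require Import structures.
From mathcomp Require Import all_boot all_order all_algebra.
From mathcomp Require Import all_classical all_reals all_analysis.
From mathcomp Require Import finmap measurable_realfun.
From mathcomp Require Import ring lra zify.

Set Implicit Arguments.
Unset Strict Implicit.
Unset Printing Implicit Defensive.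

Import Order.TTheory GRing.Theory Num.Theory.
Import numFieldNormedType.Exports.
Import HBNNSimple.

Local Open Scope classical_set_scope.
Local Open Scope ring_scope.

(** * Hierarchical interpolation of truncated linear functions *)

(** Without the projection, level m would cost its coefficient size 2^-m times the standard
    deviation sqrt(n) 2^(-m/2) of the noise along one of its vectors; the coarsest levels would then
    cost T, which is only the slow rate. Projecting them out trades this for a dimension, and 2^M =
    T 2^(-3M/2) at 2^M = T^(2/5). In the tail, M^(s-1) counts the ways to share a level among s
    coordinates and M^(1/2) is the root of the log-cardinality in the maximum.

    No entropy of the class is computed: a function is a signed mixture of atoms and an atom a
    combination of finitely many vectors, so suprema become finite maxima. The spacing bounds the
    number of design points in a dyadic cell, hence the norms, and fixes the depth at which the
    expansion is exact on the design.

    The estimator is an arbitrary minimizer at each outcome and may fail to be measurable. Its error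
    is therefore bounded outcome by outcome by an explicit measurable variable, and only the mean of
    the latter is estimated. *)

Section Univariate.
Variable R : realType.
Implicit Types (L M r t x : R).

(* Error at t of interpolating s |-> (x - s)_+ linearly between s = L and s = r. *)
Definition interp_error L r t x : R :=
  Num.max (x - t) 0 -
  (Num.max (x - L) 0 * (r - t) + Num.max (x - r) 0 * (t - L)) / (r - L).

(* This is [interp_error L r] at the midpoint, a nonpositive tent in x. *)
Definition tent L r x : R :=
  Num.max (x - (L + r) / 2) 0 - (Num.max (x - L) 0 + Num.max (x - r) 0) / 2.

Lemma max0_cases (z : R) : (z <= 0 /\ Num.max z 0 = 0) \/ (0 < z /\ Num.max z 0 = z).
Proof. by case: (leP z 0) => h; [left|right]. Qed.

Lemma interp_error_split L r t x : L < r ->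
  interp_error L r t x =
  (if t < (L + r) / 2 then (t - L) / ((r - L) / 2) * tent L r x
   else (r - t) / ((r - L) / 2) * tent L r x) +
  (if t < (L + r) / 2 then interp_error L ((L + r) / 2) t x
   else interp_error ((L + r) / 2) r t x).
Proof.
move=> Lr; have h : r - L != 0 by lra.
rewrite /interp_error /tent; case: ifP => _.
  have -> : (L + r) / 2 - L = (r - L) / 2 by field.
  by field.
have -> : r - (L + r) / 2 = (r - L) / 2 by field.
by field.
Qed.

(** The kink of s |-> (x - s)_+ is at s = x; if it is not inside the interval, the function is
    affine there and interpolation is exact. *)
Lemma interp_error_out L r t x : L < r -> L <= t -> t <= r ->
  ~~ (L < x < r) -> interp_error L r t x = 0.
Proof.
move=> Lr Lt tr; rewrite negb_and -!leNgt /interp_error => hx.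
have h : r - L != 0 by lra.
case/orP: hx => hx.
  have -> : Num.max (x - t) 0 = 0 by apply/max_idPr; lra.
  have -> : Num.max (x - L) 0 = 0 by apply/max_idPr; lra.
  have -> : Num.max (x - r) 0 = 0 by apply/max_idPr; lra.
  by rewrite !mul0r addr0 mul0r subr0.
have -> : Num.max (x - t) 0 = x - t by apply/max_idPl; lra.
have -> : Num.max (x - L) 0 = x - L by apply/max_idPl; lra.
have -> : Num.max (x - r) 0 = x - r by apply/max_idPl; lra.
by field.
Qed.

Lemma interp_error_le L r t x : L < r -> L <= t -> t <= r ->
  `|interp_error L r t x| <= r - L.
Proof.
move=> Lr Lt tr; have [/andP[Lx xr]|/interp_error_out->//] := boolP (L < x < r).
  rewrite /interp_error.
  have -> : Num.max (x - L) 0 = x - L by apply/max_idPl; lra.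
  have -> : Num.max (x - r) 0 = 0 by apply/max_idPr; lra.
  rewrite mul0r addr0.
  have h : 0 <= (r - t) / (r - L) <= 1.
    by rewrite divr_ge0 ?ler_pdivrMr ?subr_gt0 //=; lra.
  rewrite -mulrA; set q := (r - t) / (r - L) in h *.
  have h2 : 0 <= (x - L) * q <= r - L by nra.
  by case: (max0_cases (x - t)) => -[? ->]; rewrite ler_norml; lra.
by rewrite normr0; lra.
Qed.

Lemma tent_out L r x : L < r -> ~~ (L < x < r) -> tent L r x = 0.
Proof.
move=> Lr hx; have h : r - L != 0 by lra.
have := @interp_error_out L r ((L + r) / 2) x Lr _ _ hx.
rewrite /interp_error /tent => E; rewrite -[RHS]E; [|lra..].
congr (_ - _); by field.
Qed.

Lemma tent_le L r x : L < r -> `|tent L r x| <= r - L.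
Proof.
move=> Lr; have h : r - L != 0 by lra.
have := @interp_error_le L r ((L + r) / 2) x Lr _ _.
rewrite /interp_error /tent => E; have -> : (Num.max (x - L) 0 + Num.max (x - r) 0) / 2 = 
  (Num.max (x - L) 0 * (r - (L + r) / 2) +
       Num.max (x - r) 0 * ((L + r) / 2 - L)) / (r - L) by field.
by apply: E; lra.
Qed.

Definition cell (k : nat) t : nat := Num.truncn (t * 2 ^+ k).
Definition node (k a : nat) : R := a%:R / 2 ^+ k.

Lemma nodeS k a : node k a.+1 = node k a + 2 ^- k.
Proof. by rewrite /node -natr1 mulrDl mul1r. Qed.

Lemma node_lt k a : node k a < node k a.+1.
Proof. by rewrite nodeS ltrDl invr_gt0 exprn_gt0. Qed.

Lemma cell_itv k t : 0 <= t -> node k (cell k t) <= t < node k (cell k t).+1.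
Proof.
move=> t0; rewrite /node ler_pdivrMr ?exprn_gt0 // ltr_pdivlMr ?exprn_gt0 //.
by apply: truncn_itv; rewrite mulr_ge0 // exprn_ge0.
Qed.

Lemma cell_lt k t : 0 <= t < 1 -> (cell k t < 2 ^ k)%N.
Proof.
move=> /andP[t0 t1]; rewrite truncn_lt_nat; last by rewrite mulr_ge0 ?exprn_ge0.
by rewrite natrX gtr_pMl // exprn_gt0.
Qed.

Lemma cellP k t a : 0 <= t -> node k a <= t < node k a.+1 -> cell k t = a.
Proof.
move=> t0; rewrite /node ler_pdivrMr ?exprn_gt0 // ltr_pdivlMr ?exprn_gt0 // => h.
exact: truncn_def.
Qed.

Lemma node_double k a : node k.+1 a.*2 = node k a.
Proof.
rewrite /node -muln2 natrM exprS invfM mulrA mulfK //.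
Qed.

Lemma node_mid k a : node k.+1 a.*2.+1 = (node k a + node k a.+1) / 2.
Proof.
rewrite nodeS node_double [node k a.+1]nodeS exprS invfM.
by field; rewrite expf_neq0 // pnatr_eq0.
Qed.

Definition cell_error k t x :=
  interp_error (node k (cell k t)) (node k (cell k t).+1) t x.

(** The Faber hat functions of level [k]: on each dyadic cell, 0 at the ends and 1 at the
    midpoint. *)
Definition hat k t : R :=
  let L := node k (cell k t) in let r := node k (cell k t).+1 in
  (if t < (L + r) / 2 then t - L else r - t) / ((r - L) / 2).

Lemma hat_itv k t : 0 <= t -> 0 <= hat k t <= 1.
Proof.
move=> t0; have /andP[h1 h2] := cell_itv k t0; have := node_lt k (cell k t).
rewrite /hat; move: (node k _) (node k _.+1) h1 h2 => L r *.
by case: ifP => h; rewrite divr_ge0 ?ler_pdivrMr //; lra.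
Qed.

Lemma cell_errorS k t x : 0 <= t ->
  cell_error k t x =
  hat k t * tent (node k (cell k t)) (node k (cell k t).+1) x
  + cell_error k.+1 t x.
Proof.
move=> t0; rewrite /cell_error interp_error_split ?node_lt //.
have /andP[h1 h2] := cell_itv k t0; rewrite /hat.
case: ifP => h.
  have -> : cell k.+1 t = (cell k t).*2.
    by apply: cellP => //; rewrite node_double node_mid h h1.
  by rewrite node_mid node_double.
have -> : cell k.+1 t = (cell k t).*2.+1.
  by apply: cellP => //; rewrite -doubleS node_double node_mid h2 leNgt h.
by rewrite -doubleS node_double node_mid.
Qed.

Lemma cell_error_sum K t x : 0 <= t ->
  cell_error 0 t x =
  \sum_(k < K) hat k t * tent (node k (cell k t)) (node k (cell k t).+1) x
  + cell_error K t x.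
Proof.
move=> t0; elim: K => [|K IH]; first by rewrite big_ord0 add0r.
by rewrite big_ord_recr /= -addrA -cell_errorS.
Qed.

(** At level 0 the nodes are 0 and 1; as x <= 1, the value at node 1 vanishes and only (1 - t) x
    remains. *)
Lemma cell_error0 t x : 0 <= t < 1 -> 0 <= x <= 1 ->
  Num.max (x - t) 0 = (1 - t) * x + cell_error 0 t x.
Proof.
move=> /andP[t0 t1] /andP[x0 x1]; rewrite /cell_error /interp_error.
have := @cell_lt 0 t; rewrite t0 t1 expn0 ltnS leqn0 => /(_ isT) /eqP ->.
rewrite /node expr0 !divr1 /= !subr0.
have -> : Num.max x 0 = x by apply/max_idPl; lra.
have -> : Num.max (x - 1) 0 = 0 by apply/max_idPr; lra.
by rewrite mul0r addr0 divr1; ring.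
Qed.

End Univariate.

(** * The dyadic dictionary of one coordinate of the design *)

Section UnivariateDictionary.
Variable R : realType.

Definition spaced (rho : R) (N : nat) (u : nat -> R) : Prop :=
  [/\ (2 <= N)%N, u 0%N = 0,
      forall i, (i.+1 < N)%N -> u i < u i.+1,
      u N.-1 <= 1
    & forall i, (i.+1 < N)%N -> rho / N%:R <= u i.+1 - u i].

Variables (rho : R) (N : nat) (u : nat -> R).
Hypotheses (rho0 : 0 < rho) (uP : spaced rho N u).

Lemma spaced_gap i k : (i + k < N)%N -> k%:R * (rho / N%:R) <= u (i + k) - u i.
Proof.
case: uP => _ _ _ _ gap; elim: k => [|k IH]; first by rewrite addn0 subrr mul0r.
rewrite addnS => h; have := IH (ltnW h); have := gap _ h; rewrite -natr1 mulrDl mul1r.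
lra.
Qed.

Lemma spaced_gap_sub i j : (i <= j)%N -> (j < N)%N ->
  (j - i)%:R * (rho / N%:R) <= u j - u i.
Proof. by move=> ij jN; have := @spaced_gap i (j - i); rewrite subnKC //; apply. Qed.

Lemma spaced_inj i j : (i < N)%N -> (j < N)%N -> u i = u j -> i = j.
Proof.
have N0 : 0 < N%:R :> R by case: uP => N2 _ _ _ _; rewrite ltr0n; lia.
have H a b : (a < b)%N -> (b < N)%N -> u a < u b.
  move=> ab bN; have := spaced_gap_sub (ltnW ab) bN.
  have : 0 < (b - a)%:R * (rho / N%:R) by rewrite mulr_gt0 ?divr_gt0 // ltr0n subn_gt0.
  lra.
move=> iN jN E; case: (ltngtP i j) => // h.
  by have := H _ _ h jN; rewrite E ltxx.
by have := H _ _ h iN; rewrite E ltxx.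
Qed.

Lemma spaced_itv i : (i < N)%N -> 0 <= u i <= 1.
Proof.
case: uP => N2 u0 _ u1 _ iN.
have N0 : 0 < N%:R :> R by rewrite ltr0n; lia.
have P k : 0 <= k%:R * (rho / N%:R) by rewrite mulr_ge0 ?divr_ge0 // ltW.
have := @spaced_gap 0 i; rewrite add0n u0 subr0 => /(_ iN) h1.
have h2 : (N.-1 - i)%:R * (rho / N%:R) <= u N.-1 - u i by apply: spaced_gap_sub; lia.
have := P i; have := P (N.-1 - i)%N; lra.
Qed.

Lemma spaced_le : rho / N%:R <= 1.
Proof.
case: uP => N2 u0 _ u1 _; have := @spaced_gap 0 1; rewrite u0 add0n subr0 mul1r.
by move=> /(_ N2) h; have /andP[_ h2] := spaced_itv N2; exact: le_trans h h2.
Qed.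

Lemma spaced_count (L r : R) : L < r ->
  \sum_(i < N) (L < u i < r)%R%:R <= (r - L) * N%:R / rho + 1.
Proof.
move=> Lr; case: (uP) => N2 _ _ _ _.
have N0 : 0 < N%:R :> R by rewrite ltr0n; lia.
set Q := fun i : 'I_N => L < u i < r.
have y0 : 0 <= (r - L) * N%:R / rho by rewrite !mulr_ge0 ?invr_ge0 ?subr_ge0 // ltW.
case: (pickP Q) => [i0 Qi0|Q0]; last first.
  by rewrite big1 ?addr_ge0 // => i _; move: (Q0 i); rewrite /Q => ->.
case: (@arg_minnP _ i0 Q (fun i => i : nat) Qi0) => j Qj jmin.
set X := Num.truncn ((r - L) * N%:R / rho).
have hX i : Q i -> (i - j <= X)%N.
  move=> Qi; rewrite truncn_ge_nat //.
  have ji := jmin _ Qi; have h := spaced_gap_sub ji (ltn_ord i).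
  move: Qi Qj => /andP[a1 a2] /andP[b1 b2].
  have h2 : (i - j)%:R * (rho / N%:R) <= r - L by lra.
  by rewrite ler_pdivlMr // -ler_pdivrMr // -mulrA.
have -> : \sum_(i < N) (L < u i < r)%R%:R = #|[pred i | Q i]|%:R :> R.
  by rewrite -natr_sum -sum1_card [in RHS]big_mkcond; congr (_%:R).
have : (#|[pred i | Q i]| <= #|'I_X.+1|)%N.
  rewrite -(@card_in_imset _ _ (fun i : 'I_N => inord (i - j) : 'I_X.+1)) ?max_card //.
  move=> a b; rewrite !inE => Qa Qb /(congr1 val) /=.
  rewrite !inordK ?ltnS ?hX // => E; apply: val_inj => /=.
  have := jmin _ Qa; have := jmin _ Qb; lia.
rewrite card_ord -(ler_nat R) => /le_trans -> //.
by rewrite -natr1 lerD2r truncn_le.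
Qed.

(** [K] is the least depth at which dyadic cells are no longer than the guaranteed spacing
    [rho / N]. Minimality gives the other two bounds, except that for [K = 0] the last one comes
    from [rho <= N]. *)
Lemma dictionary_depth : exists K : nat,
  [/\ N%:R <= rho * 2 ^+ K, (forall k, (k < K)%N -> rho * 2 ^+ k < N%:R)
    & rho * 2 ^+ K <= 2 * N%:R].
Proof.
have ex : exists K : nat, N%:R <= rho * 2 ^+ K.
  exists (Num.truncn (N%:R / rho)).+1; rewrite -ler_pdivrMl // mulrC.
  rewrite (le_trans (ltW (truncnS_gt _))) // -natrX ler_nat ltnW //.
  exact: ltn_expl.
exists (ex_minn ex); case: ex_minnP => K h1 h2.
have h3 k : (k < K)%N -> rho * 2 ^+ k < N%:R.
  by move=> kK; rewrite ltNge; apply/negP => /h2; rewrite leqNgt kK.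
split => //; case: K h1 h2 h3 => [|K] h1 h2 h3.
  have := spaced_le; case: uP => N2 _ _ _ _.
  have N0 : 0 < N%:R :> R by rewrite ltr0n; lia.
  by rewrite ler_pdivrMr // mul1r expr0 mulr1 => h; lra.
by have := h3 K (ltnSn _); rewrite exprS; lra.
Qed.

(* Level 0 is (1 - t) x, level k + 1 the tents on the dyadic cells of length
   2^-k.  The expansion stops at the depth where a cell contains at most
   two design points: the last level consists of indicators of design points,
   with the remaining interpolation error as coefficients, so that the identity
   is exact on the design. *)
Lemma multiscale_dictionary1 :
  exists (K : nat) (c b : nat -> nat -> R -> R),
  [/\ forall t i Kb, 0 <= t < 1 -> (i < N)%N -> (K <= Kb)%N ->
        Num.max (u i - t) 0 = \sum_(k < Kb) \sum_(a < 2 ^ k) c k a t * b k a (u i),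
      forall t k, 0 <= t < 1 -> \sum_(a < 2 ^ k) `|c k a t| <= 4 * 2 ^- k,
      forall k a, \sum_(i < N) b k a (u i) ^+ 2 <= (4 / rho + 4) * N%:R * 2 ^- k
    & forall a x, b 0%N a x = x].
Proof.
case: (uP) => N2 u0 _ _ _; have N0 : 0 < N%:R :> R by rewrite ltr0n; lia.
have [K [hK1 hK2 hK3]] := dictionary_depth.
have p2 k : 0 < 2 ^+ k :> R by rewrite exprn_gt0.
(* The scale 2^-k' is moved from the tents to the coefficients, which leaves vectors with entries of
   size at most 1. The cells of [0, 1) fill half of the 2^(k'+1) positions of level k'+1. *)
pose c k a t : R := match k with
  | 0 => 1 - t
  | k'.+1 => if (k' < K)%N then (a == cell k' t)%:R * hat k' t * 2 ^- k'
             else if (k' == K) && (a < N)%N then cell_error K t (u a) else 0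
  end.
pose b k a x : R := match k with
  | 0 => x
  | k'.+1 => if (k' < K)%N then tent (node R k' a) (node R k' a.+1) x * 2 ^+ k'
             else if (k' == K) && (a < N)%N then (x == u a)%:R else 0
  end.
exists K.+2, c, b; split => //.
- move=> t i Kb t01 iN hKb; have t0 : 0 <= t by case/andP: t01.
  rewrite (cell_error0 t01 (spaced_itv iN)) (cell_error_sum K) //.
  rewrite -(big_mkord xpredT (fun k => \sum_(a < 2 ^ k) c k a t * b k a (u i))).
  have tail : \sum_(K.+2 <= k < Kb) \sum_(a < 2 ^ k) c k a t * b k a (u i) = 0.
    rewrite big_nat_cond big1 // => k /andP[/andP[hk _] _].
    apply: big1 => a _; case: k hk a => // k hk a /=.
    by rewrite ltnNge (ltnW (hk : (K < k)%N)) /= (gtn_eqF (hk : (K < k)%N)) /= mul0r.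
  rewrite (big_cat_nat (n := K.+2)) //= tail addr0.
  rewrite big_mkord big_ord_recl /= big_ord1 /=; congr (_ + _).
  rewrite big_ord_recr /=; congr (_ + _).
  + apply: eq_bigr => k _; rewrite /bump /= add1n ltn_ord.
    have hc : (cell k t < 2 ^ k.+1)%N.
      by rewrite (leq_trans (cell_lt k t01)) // leq_pexp2l.
    rewrite (bigD1 (Ordinal hc)) //= eqxx.
    rewrite big1 ?addr0; last first.
      move=> a /negP ha; case: eqP => [E|_]; last by rewrite !mul0r.
      by case: ha; apply/eqP/val_inj.
    by rewrite mul1r; field; rewrite gt_eqF.
  + rewrite /bump /= add1n ltnn eqxx /=.
    (* The last level must have room for all design points: (N - 1) rho / N <= 1 and N >= 2 give rho
       <= 2, hence N <= rho 2^K <= 2^(K+1). *)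
    have NK : (N <= 2 ^ K.+1)%N.
      rewrite -(ler_nat R) natrX exprS; have := p2 K; have := hK1; have := hK3.
      have : rho <= 2; last by have := p2 K; nra.
      have : (N.-1 - 0)%:R * (rho / N%:R) <= u N.-1 - u 0%N by apply: spaced_gap_sub; lia.
      rewrite subn0 u0 subr0 mulrA ler_pdivrMr //.
      have /andP[_ h] : 0 <= u N.-1 <= 1 by apply: spaced_itv; lia.
      have : 2 <= N%:R :> R by rewrite (ler_nat R 2).
      have -> : N.-1%:R = N%:R - 1 :> R by rewrite -subn1 natrB //; lia.
      by nra.
    have iK : (i < 2 ^ K.+1)%N by exact: leq_trans NK.
    rewrite (bigD1 (Ordinal iK)) //= iN eqxx mulr1 big1 ?addr0 // => a ha.
    case: ifP => aN; last by rewrite mul0r.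
    case: eqP => [E|_]; last by rewrite mulr0.
    case/eqP: ha; apply: val_inj => /=; exact: spaced_inj.
- move=> t k t01; have t0 : 0 <= t by case/andP: t01.
  case: k => [|k] /=; first by rewrite big_ord1 expr0 invr1 mulr1 ger0_norm; lra.
  have p2k := p2 k; rewrite exprS invfM.
  have q0 : 0 < 2 ^- k :> R by rewrite invr_gt0.
  case: ltnP => kK.
    have hh := hat_itv k t0.
    apply: (@le_trans _ _ (2 ^- k)); last by lra.
    have hc : (cell k t < 2 ^ k.+1)%N.
      by rewrite (leq_trans (cell_lt k t01)) // leq_pexp2l.
    rewrite (bigD1 (Ordinal hc)) //= eqxx.
    rewrite big1 ?addr0; last first.
      move=> a /negP ha; case: eqP => [E|_]; last by rewrite !mul0r normr0.
      by case: ha; apply/eqP/val_inj.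
    by rewrite mul1r ger0_norm; nra.
  case: eqP => [Ek|_] /=; last by rewrite big1 ?normr0 // => *; nra.
  subst k.
  have /andP[e1 e2] := cell_itv K t0; have e3 := node_lt R K (cell K t).
  set L := node R K _ in e1 e2 e3; set r := node R K _ in e2 e3.
  have rL : r - L = 2 ^- K by rewrite /r nodeS addrC addKr.
  (* The error is at most 2^-K and vanishes off the open cell, which holds at most two design
     points; 2 * 2^-K is the claimed 4 * 2^-(K+1). *)
  apply: (@le_trans _ _ (\sum_(i < N) (L < u i < r)%R%:R * 2 ^- K)).
    rewrite -(big_mkord xpredT (fun a => `|if (a < N)%N then cell_error K t (u a) else 0|)).
    rewrite -(big_mkord xpredT (fun a => (L < u a < r)%R%:R * 2 ^- K)).
    have S m : \sum_(0 <= i < m) `|if (i < N)%N then cell_error K t (u i) else 0|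
       <= \sum_(0 <= i < N) `|cell_error K t (u i)|.
      rewrite (@le_trans _ _ (\sum_(0 <= i < N + m) `|if (i < N)%N then cell_error K t (u i) else 0|)) //.
        rewrite [X in _ <= X](big_cat_nat (n := m)) ?leq_addl //= lerDl.
        by apply: sumr_ge0.
      have tail : \sum_(N <= i < N + m) `|if (i < N)%N then cell_error K t (u i) else 0| = 0.
        by rewrite big_nat_cond big1 // => i /andP[/andP[h _] _]; rewrite ltnNge h normr0.
      rewrite (big_cat_nat (n := N)) ?leq_addr //= tail addr0.
      by rewrite !big_mkord; apply: ler_sum => i _; rewrite ltn_ord.
    rewrite (le_trans (S _)) // !big_mkord ler_sum // => i _.
    case: (boolP (_ < u i < _)) => h; first by rewrite mul1r -rL interp_error_le // ltW.
    by rewrite mul0r /cell_error interp_error_out ?normr0 // ltW.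
  rewrite -mulr_suml; have := spaced_count e3; rewrite rL => h.
  have h2 : 2 ^- K * N%:R / rho <= 1.
    by rewrite ler_pdivrMr // mul1r mulrC ler_pdivrMr.
  nra.
- move=> k a; case: k => [|k] /=.
    rewrite expr0 invr1 mulr1; apply: (@le_trans _ _ (\sum_(i < N) 1)).
      apply: ler_sum => i _; have /andP[? ?] := spaced_itv (ltn_ord i).
      by rewrite -[1](expr1n _ 2) lerXn2r // nnegrE.
    rewrite sumr_const card_ord; have : 0 < 4 / rho by rewrite divr_gt0.
    by nra.
  rewrite exprS invfM; have p2k := p2 k; have q0 : 0 < 2 ^- k :> R by rewrite invr_gt0.
  have r0 : 0 < rho^-1 by rewrite invr_gt0.
  have rr : rho * rho^-1 = 1 by rewrite divff // gt_eqF.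
  have qq : 2 ^- k * 2 ^+ k = 1 :> R by rewrite mulVf // gt_eqF.
  set Q := 2 ^- k in q0 qq *; set P := 2 ^+ k in p2k qq *.
  case: ltnP => kK.
    have e3 := node_lt R k a; set L := node R k a in e3 *; set r := node R k a.+1 in e3 *.
    have rL : r - L = Q by rewrite /r nodeS addrC addKr.
    apply: (@le_trans _ _ (\sum_(i < N) (L < u i < r)%R%:R)).
      apply: ler_sum => i _.
      case: (boolP (_ < u i < _)) => h; last by rewrite tent_out // mul0r expr0n.
      rewrite -real_normK ?num_real // -[X in _ <= X](expr1n _ 2) lerXn2r ?nnegrE //.
      by rewrite normrM (gtr0_norm p2k) -qq -rL ler_wpM2r ?(ltW p2k) // tent_le.
    apply: (le_trans (spaced_count e3)); rewrite rL.
    (* Before depth [K] a cell is longer than the spacing, so the summand 1 in [spaced_count] is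
       absorbed by the main term. *)
    have h1 : 1 <= Q * N%:R * rho^-1.
      have := hK2 _ kK; rewrite -/P => /ltW h.
      have := ler_wpM2r (ltW (mulr_gt0 q0 r0)) h.
      have -> : rho * P * (Q * rho^-1) = 1 by rewrite mulrCA [_ * P]mulrC -!mulrA rr mulr1.
      by rewrite mulrCA mulrA.
    have : 0 < N%:R * Q by rewrite mulr_gt0.
    by nra.
  case: andP => [[/eqP Ek aN]|_]; last first.
    rewrite big1 => [|i _]; last by rewrite expr0n.
    by rewrite !mulr_ge0 ?addr_ge0 ?mulr_ge0 // ltW.
  subst k; rewrite (bigD1 (Ordinal aN)) //= eqxx expr1n big1 ?addr0; last first.
    move=> i; rewrite -val_eqE /= => ia; case: eqP => [E|_]; last by rewrite expr0n.
    by rewrite (spaced_inj (ltn_ord i) aN E) eqxx in ia.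
  have := ler_wpM2r (ltW (mulr_gt0 q0 r0)) hK3.
  have -> : rho * P * (Q * rho^-1) = 1 by rewrite mulrCA [_ * P]mulrC -!mulrA rr mulr1.
  have : 0 < N%:R * Q by rewrite mulr_gt0.
  by nra.
Qed.
End UnivariateDictionary.

(** * Tensor-product dictionary on the lattice *)

Section LatticeSum.
Variables (R : realType) (d n : nat) (rho : R) (N : 'I_d -> nat).
Variables (u : 'I_d -> nat -> R) (x : 'I_n -> d.-tuple R).
Hypotheses (rho0 : 0 < rho) (lat : lattice_design rho N u x).

Lemma lattice_spaced k : spaced rho (N k) (u k).
Proof. by case: lat => _ _; apply. Qed.

Lemma lattice_mem i j : exists2 l, (l < N j)%N & tnth (x i) j = u j l.
Proof. by case: lat => _ E _; have : range x (x i) by []; rewrite E; apply. Qed.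

Lemma lattice_prod_natr : n%:R = \prod_(k < d) (N k)%:R :> R.
Proof. by case: lat => nE _ _; rewrite [in LHS]nE natr_prod. Qed.

(** The design is given only through its range, and a repeated point would break the identity. As
    [n] is the cardinality of the grid, the surjection onto grid indices is a bijection, and the sum
    over the grid factorises. *)
Lemma lattice_sum (g : 'I_d -> R -> R) :
  \sum_(i < n) \prod_(j < d) g j (tnth (x i) j)
  = \prod_(j < d) \sum_(l < N j) g j (u j l).
Proof.
case: (lat) => nE xE _; set L := (\max_j N j)%N.
have NL j : (N j <= L.+1)%N by rewrite (leq_trans (leq_bigmax j)).
pose Q (j : 'I_d) := [pred l : 'I_L.+1 | (l < N j)%N].
have /choice[iota iotaP] (i : 'I_n) : exists f : {ffun 'I_d -> 'I_L.+1},
    (f \in family Q) /\ forall j, tnth (x i) j = u j (f j).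
  have /choice[l lP] j : exists l : 'I_L.+1, (l < N j)%N /\ tnth (x i) j = u j l.
    have [l lN E] := lattice_mem i j.
    by exists (Ordinal (leq_trans lN (NL j))).
  exists (finfun l); split; last by move=> j; rewrite ffunE; case: (lP j).
  by apply/familyP => j; rewrite ffunE inE; case: (lP j).
have surj f : f \in family Q -> exists i, iota i = f.
  move=> /familyP fQ.
  have : range x [tuple u j (f j) | j < d].
    by rewrite xE /= => j; exists (f j); [exact: fQ|rewrite tnth_mktuple].
  move=> [i _ xi]; exists i; apply/ffunP => j; apply: val_inj => /=.
  have [/familyP h1 h2] := iotaP i.
  apply: (spaced_inj rho0 (lattice_spaced j)); [exact: h1|exact: fQ|].
  by rewrite -h2 xi tnth_mktuple.
have cardQ : #|family Q| = n.
  rewrite -sum1_card nE; transitivity (\sum_(f in family Q) \prod_(j < d) 1)%N.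
    by apply: eq_bigr => f _; rewrite big1.
  rewrite -(bigA_distr_big_dep Q (fun _ _ => 1%N)); apply: eq_bigr => j _.
  by rewrite -(big_ord_widen _ (fun=> 1%N) (NL j)) sum1_card card_ord.
have im : iota @: 'I_n =i family Q.
  move=> f; apply/imsetP/idP => [[i _ ->]|/surj[i <-]]; last by exists i.
  by case: (iotaP i).
have inj : injective iota.
  have : #|iota @: 'I_n| == #|'I_n| by rewrite (eq_card im) cardQ card_ord.
  by move/imset_injP => h a b; apply: h.
transitivity (\sum_(i in 'I_n) \prod_(j < d) g j (u j (iota i j))).
  by apply: eq_bigr => i _; apply: eq_bigr => j _; case: (iotaP i) => _ ->.
rewrite -(big_imset (fun f : {ffun 'I_d -> 'I_L.+1} => \prod_(j < d) g j (u j (f j)))) /=;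
  last by move=> a b _ _; exact: inj.
rewrite (eq_bigl _ _ im) -(bigA_distr_big_dep Q (fun j l => g j (u j l))).
by apply: eq_bigr => j _; rewrite -(big_ord_widen _ (fun l => g j (u j l)) (NL j)).
Qed.
End LatticeSum.

Lemma pfamily_out (aT : finType) (rT : eqType) (y : rT) (D : {pred aT})
    (F : aT -> pred rT) (f : {ffun aT -> rT}) j :
  f \in pfamily y D F -> j \notin D -> f j = y.
Proof.
move=> /pfamilyP[/fintype.subsetP h _] jD; apply/eqP; apply: contraNT jD => fj.
exact: h.
Qed.

Section Levels.
Variables (d Kb A : nat) (alpha : {set 'I_d}).

(* The levels kappa and positions within a level are only meaningful on alpha;
   both are pinned to 0 elsewhere. *)
Definition level_maps := pfamily (ord0 : 'I_Kb.+1) alpha (fun=> xpredT).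

Definition position_maps (kappa : {ffun 'I_d -> 'I_Kb.+1}) :=
  pfamily (ord0 : 'I_A.+1) alpha (fun j => [pred a : 'I_A.+1 | (a < 2 ^ kappa j)%N]).

(** Given the sum [m], the level at one element [j0] of [alpha] is determined by the others, which
    saves one factor [m.+1]. For empty [alpha] there is just one map. *)
Lemma card_level_maps m :
  (#|[pred kappa in level_maps | \sum_(j in alpha) kappa j == m]%N|
   <= m.+1 ^ #|alpha|.-1)%N.
Proof.
have [alpha0|/set0Pn[j0 j0a]] := eqVneq alpha finset.set0.
  rewrite {2}alpha0 cards0 expn0; apply/card_le1_eqP => k1 k2.
  move=> /andP[h1 _] /andP[h2 _].
  have off j : j \notin alpha by rewrite alpha0 finset.in_set0.
  by apply/ffunP => j; rewrite (pfamily_out h1 (off j)) (pfamily_out h2 (off j)).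
pose g (kappa : {ffun 'I_d -> 'I_Kb.+1}) : {ffun 'I_d -> 'I_m.+1} :=
  [ffun j => if j \in alpha :\ j0 then inord (kappa j) else ord0].
set S := [pred kappa in _ | _].
have le_m kappa j : kappa \in S -> j \in alpha -> (kappa j < m.+1)%N.
  by move=> /andP[_ /eqP <-] ja; rewrite ltnS (bigD1 j) //= leq_addr.
have inj : {in S &, injective g}.
  move=> k1 k2 h1 h2 E.
  have E1 j : j \in alpha :\ j0 -> k1 j = k2 j.
    move=> ja; have : j \in alpha by case/setD1P: ja.
    move=> ja'; have := congr1 (fun f : {ffun 'I_d -> 'I_m.+1} => nat_of_ord (f j)) E.
    rewrite /g !ffunE ja !inordK ?le_m // => h; exact: val_inj.
  have E0 : k1 j0 = k2 j0.
    move: h1 h2 => /andP[_ /eqP s1] /andP[_ /eqP s2].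
    move: s1; rewrite -s2 (big_setD1 j0) //= [in RHS](big_setD1 j0) //=.
    rewrite (eq_bigr (fun j => nat_of_ord (k2 j))); last by move=> j /E1 ->.
    by move/addIn => h; apply: val_inj.
  apply/ffunP => j; case: (boolP (j \in alpha)) => ja.
    by case: (eqVneq j j0) => [->//|jj0]; apply: E1; rewrite in_setD1 jj0.
  move: h1 h2 => /andP[h1 _] /andP[h2 _].
  by rewrite (pfamily_out h1 ja) (pfamily_out h2 ja).
rewrite -(card_in_imset inj).
have -> : #|alpha|.-1 = #|alpha :\ j0| by rewrite (cardsD1 j0 alpha) j0a.
rewrite -[X in (_ <= X ^ _)%N](card_ord m.+1) -(card_pffun_on ord0 (alpha :\ j0) 'I_m.+1).
apply: subset_leq_card; apply/fintype.subsetP => f /imsetP[kappa _ ->].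
apply/pffun_onP; split => [|//].
by apply/fintype.subsetP => j; rewrite inE /g ffunE; case: ifP => // _; rewrite eqxx.
Qed.

Lemma card_position_maps kappa :
  (#|position_maps kappa| <= 2 ^ (\sum_(j in alpha) kappa j))%N.
Proof.
rewrite -sum1_card expn_sum.
have -> : (\sum_(f in position_maps kappa) 1
  = \sum_(f in position_maps kappa) \prod_(j in alpha) 1)%N.
  by apply: eq_bigr => f _; rewrite big1.
rewrite -(@big_distr_big_dep _ _ _ _ _ _ _ ord0 (mem alpha)
   (fun j => [pred a : 'I_A.+1 | (a < 2 ^ kappa j)%N]) (fun _ _ => 1%N)).
apply: leq_prod => j _; rewrite sum1_card.
have [h|h] := leqP (2 ^ kappa j) A.+1.
  by rewrite -sum1_card -(big_ord_widen _ (fun=> 1%N) h) sum1_card card_ord.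
by rewrite (leq_trans (max_card _)) // card_ord ltnW.
Qed.
End Levels.

(** The univariate bounds are powers of 2 in the level, so products satisfy the same bounds at the
    sum of the levels. The subset is part of the index: it contributes 2^d to the count, while an
    atom uses only the vectors of its own subset. The third clause holds because level 0 in each
    coordinate is the function x itself. *)
Lemma multiscale_dictionary (R : realType) (rho : R) (d n s : nat)
    (N : 'I_d -> nat) (u : 'I_d -> nat -> R) (x : 'I_n -> d.-tuple R) :
  0 < rho -> lattice_design rho N u x ->
  exists (J : finType) (D : pred J) (lev : J -> nat) (B : J -> 'I_n -> R),
  [/\ forall m, (#|[pred j | D j && (lev j == m)]| <= 2 ^ d * m.+1 ^ s.-1 * 2 ^ m)%N,
      forall j, D j ->
        \sum_(i < n) B j i ^+ 2 <= (4 / rho + 4) ^+ d * n%:R * 2 ^- lev j,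
      forall alpha : {set 'I_d}, (#|alpha| <= s)%N ->
        exists2 j, D j /\ lev j = 0%N &
          forall i, B j i = \prod_(k in alpha) tnth (x i) k
    & forall (alpha : {set 'I_d}) (t : 'I_d -> R), (#|alpha| <= s)%N ->
        (forall k, 0 <= t k < 1) ->
        exists2 c : J -> R,
          forall i, \prod_(k in alpha) Num.max (tnth (x i) k - t k) 0
                    = \sum_(j | D j) c j * B j i
        & forall m, \sum_(j | D j && (lev j == m)) `|c j|
                    <= 4 ^+ d * m.+1%:R ^+ s.-1 * 2 ^- m].
Proof.
move=> rho0 lat.
have dict k := multiscale_dictionary1 rho0 (lattice_spaced lat k).
have /choice[K] := dict => /choice[c] /choice[b] cbP.
(* One depth for all coordinates: the univariate expansions stay exact at any larger depth. *)
set Kb := (\max_k K k)%N; have KKb k : (K k <= Kb.+1)%N by rewrite (leq_trans (leq_bigmax k)).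
set A := (2 ^ Kb)%N.
have kA (k : 'I_Kb.+1) : (2 ^ k <= A.+1)%N.
  by rewrite (leq_trans _ (leqnSn _)) // leq_exp2l // -ltnS.
pose J : finType := ({set 'I_d} * ({ffun 'I_d -> 'I_Kb.+1} * {ffun 'I_d -> 'I_A.+1}))%type.
pose D2 (al : {set 'I_d}) := [pred p : {ffun 'I_d -> 'I_Kb.+1} * {ffun 'I_d -> 'I_A.+1} |
  (p.1 \in level_maps Kb al) && (p.2 \in position_maps A al p.1)].
pose D : pred J := fun j => (#|j.1| <= s)%N && D2 j.1 j.2.
pose lev (j : J) : nat := (\sum_(k in j.1) j.2.1 k)%N.
pose B (j : J) i := \prod_(k in j.1) b k (j.2.1 k) (j.2.2 k) (tnth (x i) k).
have sum_D2 (V : nmodType) (al : {set 'I_d}) (P : pred {ffun 'I_d -> 'I_Kb.+1}) (F : _ -> _ -> V) :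
    \sum_(p | D2 al p && P p.1) F p.1 p.2 =
    \sum_(ka in level_maps Kb al | P ka) \sum_(f in position_maps A al ka) F ka f.
  rewrite pair_big_dep; apply: eq_bigl => p /=; by rewrite andbAC.
have sum_D (V : nmodType) (P : pred J) (F : J -> V) :
    \sum_(j | D j && P j) F j =
    \sum_(al : {set 'I_d} | (#|al| <= s)%N) \sum_(p | D2 al p && P (al, p)) F (al, p).
  rewrite pair_big_dep /=; apply: eq_big.
    by move=> [al p]; rewrite /D /= !andbA.
  by move=> [al p].
exists J, D, lev, B; split.
- move=> m; rewrite -sum1_card (sum_D nat (fun j => lev j == m) (fun=> 1%N)).
  apply: (@leq_trans (\sum_(al : {set 'I_d} | (#|al| <= s)%N) m.+1 ^ s.-1 * 2 ^ m)).
    apply: leq_sum => al als.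
    rewrite (sum_D2 nat al (fun ka => \sum_(k in al) ka k == m)%N (fun _ _ => 1%N)).
    apply: (@leq_trans (\sum_(ka in level_maps Kb al | \sum_(k in al) ka k == m) 2 ^ m)%N).
      apply: leq_sum => ka /andP[_ /eqP <-]; rewrite sum1_card; exact: card_position_maps.
    rewrite sum_nat_const leq_mul2r (leq_trans (card_level_maps _ _ _)) ?orbT //.
    by apply: leq_pexp2l => //; move: als; lia.
  rewrite sum_nat_const -mulnA leq_mul2r (leq_trans (max_card _)) ?orbT //.
  by rewrite -cardsT -powersetT card_powerset cardsT card_ord.
- move=> [al [ka f]] /andP[als /andP[ka_in f_in]]; rewrite /lev /B /=.
  (* A coordinate outside the subset contributes the factor [N k], which has to fit under the same
     constant. *)
  have Crho : 1 <= 4 / rho + 4.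
    by have : 0 < 4 / rho; [rewrite divr_gt0|lra].
  pose g k y := (if k \in al then b k (ka k) (f k) y else 1) ^+ 2.
  have -> : \sum_(i < n) (\prod_(k in al) b k (ka k) (f k) (tnth (x i) k)) ^+ 2 =
     \sum_(i < n) \prod_(k < d) g k (tnth (x i) k).
    apply: eq_bigr => i _; rewrite -prodrXl big_mkcond /=; apply: eq_bigr => k _.
    by rewrite /g; case: ifP; rewrite ?expr1n.
  rewrite (lattice_sum rho0 lat).
  have -> : (4 / rho + 4) ^+ d * n%:R * 2 ^- (\sum_(k in al) ka k)
    = \prod_(k < d) ((4 / rho + 4) * (N k)%:R * (if k \in al then 2 ^- ka k else 1)).
    rewrite !big_split /= prodr_const card_ord (lattice_prod_natr lat) -big_mkcond /=.
    by rewrite prodfV -expr_sum.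
  apply: ler_prod => k _; rewrite sumr_ge0 /=; last by move=> l _; rewrite sqr_ge0.
  rewrite /g; case: ifP => _; first by case: (cbP k) => _ _ + _; apply.
  rewrite mulr1 (eq_bigr (fun=> 1)) => [|l _]; last by rewrite expr1n.
  by rewrite sumr_const card_ord ler_peMl.
- move=> al als; exists (al, ([ffun=> ord0], [ffun=> ord0])).
    rewrite /lev /= big1 => [|k _]; last by rewrite ffunE.
    split => //; rewrite /D /= als /=; apply/andP; split; apply/pfamilyP; split.
    - by apply/fintype.subsetP => k; rewrite inE /= ffunE eqxx.
    - by [].
    - by apply/fintype.subsetP => k; rewrite inE /= ffunE eqxx.
    - by move=> k _; rewrite inE /= !ffunE expn_gt0.
  move=> i; rewrite /B /=; apply: eq_bigr => k _; rewrite !ffunE /=.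
  by case: (cbP k).
- move=> al t als t01.
  pose c1 (ka : {ffun 'I_d -> 'I_Kb.+1}) (f : {ffun 'I_d -> 'I_A.+1}) :=
    \prod_(k in al) c k (ka k) (f k) (t k).
  exists (fun j => if j.1 == al then c1 j.2.1 j.2.2 else 0).
    move=> i; rewrite (eq_bigl (fun j => D j && true)) => [|j]; last by rewrite andbT.
    rewrite (sum_D _ predT) /= (bigD1 al) //= [X in _ + X]big1 ?addr0; last first.
      by move=> be /andP[_ ba]; rewrite big1 // => p _; rewrite (negbTE ba) mul0r.
    rewrite eqxx (sum_D2 _ al predT
      (fun ka f => c1 ka f * \prod_(k in al) b k (ka k) (f k) (tnth (x i) k))).
    transitivity (\prod_(k in al) \sum_(l : 'I_Kb.+1) \sum_(a : 'I_A.+1 | (a < 2 ^ l)%N)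
        c k l a (t k) * b k l a (tnth (x i) k)).
      apply: eq_bigr => k _; have [l lN ->] := lattice_mem lat i k.
      case: (cbP k) => /(_ _ _ Kb.+1 (t01 k) lN (KKb k)) -> _ _ _.
      apply: eq_bigr => l' _.
      by rewrite (big_ord_widen _ (fun a => c k l' a (t k) * b k l' a (u k l)) (kA l')).
    rewrite (big_distr_big_dep ord0); apply: eq_big => [ka|ka _]; first by rewrite andbT.
    rewrite (big_distr_big_dep ord0); apply: eq_bigr => f _.
    by rewrite big_split.
  move=> m; rewrite (sum_D _ (fun j => lev j == m)) (bigD1 al) //= [X in _ + X]big1 ?addr0; last first.
    by move=> be /andP[_ ba]; rewrite big1 // => p _; rewrite (negbTE ba) normr0.
  rewrite eqxx (sum_D2 _ al (fun ka => \sum_(k in al) ka k == m)%N (fun ka f => `|c1 ka f|)).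
  apply: (@le_trans _ _ (\sum_(ka in level_maps Kb al | (\sum_(k in al) ka k)%N == m) (4 ^+ d * 2 ^- m))).
    apply: ler_sum => ka /andP[_ /eqP <-]; rewrite /c1.
    rewrite (eq_bigr (fun f : {ffun 'I_d -> 'I_A.+1} => \prod_(k in al) `|c k (ka k) (f k) (t k)|));
      last by move=> f _; rewrite normr_prod.
    rewrite -(big_distr_big_dep ord0 (mem al) (fun k => [pred a : 'I_A.+1 | (a < 2 ^ ka k)%N])
       (fun k a => `|c k (ka k) a (t k)|)).
    apply: (@le_trans _ _ (\prod_(k in al) (4 * 2 ^- ka k))).
      apply: ler_prod => k _; rewrite sumr_ge0 //=.
      rewrite -(big_ord_widen _ (fun a => `|c k (ka k) a (t k)|) (kA (ka k))).
      by case: (cbP k) => _ + _ _; apply.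
    rewrite big_split /= prodr_const prodfV -expr_sum ler_wpM2r ?invr_ge0 ?exprn_ge0 //.
    by rewrite ler_weXn2l ?ler1n // -[X in (_ <= X)%N](card_ord d) max_card.
  rewrite sumr_const -[X in X <= _]mulr_natr [X in _ <= X]mulrAC ler_wpM2l ?mulr_ge0 ?invr_ge0 ?exprn_ge0 //.
  rewrite -natrX ler_nat (leq_trans (card_level_maps _ _ _)) //.
  by apply: leq_pexp2l => //; move: als; lia.
Qed.

(** * Linear functionals of functions in the class *)

Section MeasureFunctional.
Context (disp : measure_display) (T : measurableType disp) (R : realType).

Lemma Rintegral_sum (mu : {measure set T -> \bar R}) (D : set T) (I : Type)
    (r : seq I) (g : I -> T -> R) : measurable D ->
  (forall i, mu.-integrable D (EFin \o g i)) ->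
  mu.-integrable D (EFin \o (fun t => \sum_(i <- r) g i t)) /\
  \int[mu]_(t in D) (\sum_(i <- r) g i t) = \sum_(i <- r) \int[mu]_(t in D) g i t.
Proof.
move=> mD ig.
have is' s : mu.-integrable D (EFin \o (fun t => \sum_(i <- s) g i t)).
  have -> : EFin \o (fun t => \sum_(i <- s) g i t)
    = (fun t => \sum_(i <- s) (EFin \o g i) t)%E.
    by apply/funext => t /=; rewrite sumEFin.
  exact: integrable_sum.
split => //; elim: r => [|a r IH].
  rewrite big_nil; under eq_Rintegral do rewrite big_nil.
  by rewrite Rintegral_cst // mul0r.
rewrite big_cons -IH -RintegralD //.
by apply: eq_Rintegral => t _; rewrite big_cons.
Qed.

Lemma Rintegral_punctured_le (mu : {finite_measure set T -> \bar R}) (D : set T)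
    (z : T) (g : T -> R) (Bd : R) :
  measurable D -> measurable [set z] -> D z -> 0 <= Bd ->
  mu.-integrable D (EFin \o g) -> g z = 0 ->
  (forall t, D t -> `|g t| <= Bd) ->
  `|\int[mu]_(t in D) g t| <= Bd * fine (mu (D `\` [set z])).
Proof.
move=> mD mz Dz Bd0 ig gz gB; have mDz : measurable (D `\` [set z]) by exact: measurableD.
have DE : D = (D `\` [set z]) `|` [set z].
  by rewrite setUC setDUK // => t ->.
rewrite [in X in `|X|]DE Rintegral_setU //; last 2 first.
- by rewrite -DE.
- by apply/disj_setPS => t [[_ h] /h].
have -> : \int[mu]_(t in [set z]) g t = 0.
  rewrite (@eq_Rintegral _ _ _ mu _ (cst 0)) ?Rintegral_cst ?mul0r //.
  by move=> t /set_mem ->.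
rewrite addr0.
have ig' : mu.-integrable (D `\` [set z]) (EFin \o g).
  by apply: integrableS ig => //; exact: subDsetl.
rewrite (le_trans (le_normr_Rintegral _ ig')) // -Rintegral_cst //.
apply: le_Rintegral => //.
- exact: integrable_norm.
- apply: finite_measure_integrable_cst => //.
- by move=> t [Dt _]; exact: gB.
Qed.

(** With the sum pulled under the integral, the integrand vanishes at [z], so mass there is free.
    This applies to both Jordan parts, and their masses add up to the variation. *)
Lemma charge_functional_le (nu : {charge set T -> \bar R}) (D : set T) (z : T)
    (n : nat) (eta : 'I_n -> R) (g : 'I_n -> T -> R) (Bd : R) :
  measurable D -> measurable [set z] -> D z -> 0 <= Bd ->
  (forall i, measurable_fun D (g i)) ->
  (forall i t, D t -> `|g i t| <= 1) ->
  \sum_(i < n) eta i * g i z = 0 ->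
  (forall t, D t -> `|\sum_(i < n) eta i * g i t| <= Bd) ->
  `|\sum_(i < n) eta i * charge_integral nu D (g i)|
    <= Bd * fine (charge_total_variation nu (D `\` [set z])).
Proof.
move=> mD mz Dz Bd0 mg g1 gz gB.
have key (mu : {finite_measure set T -> \bar R}) :
    `|\sum_(i < n) eta i * \int[mu]_(t in D) g i t| <= Bd * fine (mu (D `\` [set z])).
  have ig i : mu.-integrable D (EFin \o g i).
    apply: measurable_bounded_integrable => //.
      by rewrite ltey_eq fin_num_measure.
    exists 1; split => // y y1 t Dt; exact: le_trans (g1 i t Dt) (ltW y1).
  have ige i : mu.-integrable D (EFin \o (fun t => eta i * g i t)).
    by have := integrableZl mD (eta i) (ig i); apply: eq_integrable.
  have [iS ES] := Rintegral_sum (index_enum _) mD ige.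
  have -> : \sum_(i < n) eta i * \int[mu]_(t in D) g i t
    = \int[mu]_(t in D) (\sum_(i < n) eta i * g i t).
    by rewrite ES; apply: eq_bigr => i _; rewrite RintegralZl.
  exact: Rintegral_punctured_le.
rewrite /charge_total_variation /charge_variation /= fineD ?fin_num_measure //;
  try exact: measurableD.
under eq_bigr do rewrite mulrBr.
rewrite sumrB mulrDr (le_trans (ler_normB _ _)) // lerD //; exact: key.
Qed.
End MeasureFunctional.

Section MarsFunctional.
Variables (R : realType) (d : nat).

Lemma hocubeE k : @hocube R k = \bigcap_(i in [set: 'I_k]) ((@tnth k R)^~ i @^-1` `[0, 1[%classic).
Proof.
apply/seteqP; split => t /= h i; first by move=> _; rewrite /= in_itv /=; exact: h.
by have := h i I; rewrite /= in_itv.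
Qed.

Lemma measurable_hocube k : measurable (@hocube R k).
Proof.
rewrite hocubeE; apply: fin_bigcap_measurable => // i _.
by rewrite -[X in measurable X]setTI; exact: measurable_tnth.
Qed.

Lemma measurable_zero_tuple k : measurable [set zero_tuple R k].
Proof.
have -> : [set zero_tuple R k] = \bigcap_(i in [set: 'I_k]) ((@tnth k R)^~ i @^-1` [set 0]).
  apply/seteqP; split => [t -> i _ /=|t /= h]; first by rewrite tnth_mktuple.
  by apply: eq_from_tnth => i; rewrite tnth_mktuple; apply: (h i I).
apply: fin_bigcap_measurable => // i _.
by rewrite -[X in measurable X]setTI; exact: measurable_tnth.
Qed.

Lemma measurable_atom (x : d.-tuple R) (al : {set 'I_d}) D :
  measurable_fun D (fun t : #|al|.-tuple R =>
    \prod_(i < #|al|) Num.max (tnth x (enum_val i) - tnth t i) 0).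
Proof.
apply: (@measurable_funS _ _ _ _ setT) => //.
apply: measurable_prod => i _; apply: measurable_maxr => //.
by apply: measurable_funB => //; exact: measurable_tnth.
Qed.

(** The complexity controls neither [a0] nor the masses at the origin, so [eta] is required to
    annihilate the constant and the monomials; what remains is a mixture of atoms of total mass at
    most [V]. *)
Lemma mars_functional_le (s n : nat) (a0 V Bd : R) (nu : signed_measures R d)
    (x : 'I_n -> d.-tuple R) (eta : 'I_n -> R) :
  (forall i, cube (x i)) -> 0 <= Bd ->
  \sum_(i < n) eta i = 0 ->
  (forall al : {set 'I_d}, (#|al| <= s)%N ->
     \sum_(i < n) eta i * \prod_(k in al) tnth (x i) k = 0) ->
  (forall (al : {set 'I_d}) (t : 'I_d -> R), (#|al| <= s)%N -> (forall k, 0 <= t k < 1) ->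
     `|\sum_(i < n) eta i * \prod_(k in al) Num.max (tnth (x i) k - t k) 0| <= Bd) ->
  (mars_variation s nu <= V%:E)%E ->
  `|\sum_(i < n) eta i * mars_fun s a0 nu (x i)| <= Bd * V.
Proof.
move=> xc Bd0 e0 ez eB nuV.
pose tv al := charge_total_variation (nu al) (@hocube R #|al| `\` [set zero_tuple R #|al|]).
have tvfin al : tv al \is a fin_num.
  have mD : measurable (@hocube R #|al| `\` [set zero_tuple R #|al|]).
    apply: measurableD; [exact: measurable_hocube|exact: measurable_zero_tuple].
  by rewrite /tv /charge_total_variation /charge_variation /= fin_numD !fin_num_measure.
have -> : \sum_(i < n) eta i * mars_fun s a0 nu (x i) =
  \sum_(al : {set 'I_d} | mars_index s al) \sum_(i < n) eta i *
   charge_integral (nu al) (@hocube R #|al|)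
           (fun t => \prod_(j < #|al|) Num.max (tnth (x i) (enum_val j) - tnth t j) 0).
  rewrite exchange_big /=; under eq_bigr do rewrite mulrDr.
  rewrite big_split /= -mulr_suml e0 mul0r add0r.
  by apply: eq_bigr => i _; rewrite mulr_sumr.
apply: (@le_trans _ _ (\sum_(al : {set 'I_d} | mars_index s al) Bd * fine (tv al))).
  rewrite (le_trans (ler_norm_sum _ _ _)) // ler_sum // => al /andP[_ als].
  (* Atoms are indexed by functions on all coordinates; [t] is extended by 0 outside [al]. *)
  have ext (t : #|al|.-tuple R) : hocube t -> exists2 t' : 'I_d -> R, (forall k, 0 <= t' k < 1) &
     forall j : 'I_#|al|, t' (enum_val j) = tnth t j.
    move=> ht; exists (fun k => if [pick j : 'I_#|al| | enum_val j == k] is Some j then tnth t j else 0).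
      by move=> k; case: pickP => [j _|_]; [exact: ht|rewrite lexx ltr01].
    move=> j; case: pickP => [j' /eqP /enum_val_inj -> //|/(_ j)]; by rewrite eqxx.
  apply: charge_functional_le => //.
  - exact: measurable_hocube.
  - exact: measurable_zero_tuple.
  - by move=> j; rewrite /= /zero_tuple tnth_mktuple lexx ltr01.
  - by move=> i; apply: measurable_atom.
  - move=> i t ht; rewrite ger0_norm ?prodr_ge0 //; last first.
      by move=> j _; rewrite le_max lexx orbT.
    apply: prodr_ile1 => j _; apply/andP; split; first by rewrite le_max lexx orbT.
    have /andP[x0 x1] := xc i (enum_val j); have /andP[t0 _] := ht j.
    by rewrite ge_max ler01 andbT; lra.
  - apply: etrans (ez al als); apply: eq_bigr => i _; congr (_ * _).
    rewrite [RHS]big_enum_val /=; apply: eq_bigr => j _; rewrite /zero_tuple tnth_mktuple subr0.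
    by apply/max_idPl; have /andP[] := xc i (enum_val j).
  - move=> t ht; have [t' t'01 t'E] := ext t ht.
    apply: le_trans (eB al t' als t'01); rewrite le_eqVlt; apply/orP; left; apply/eqP.
    congr (`|_|); apply: eq_bigr => i _; congr (_ * _).
    by rewrite [RHS]big_enum_val /=; apply: eq_bigr => j _; rewrite t'E.
rewrite -mulr_sumr ler_wpM2l // -lee_fin -sumEFin (le_trans _ nuV) //.
rewrite /mars_variation le_eqVlt; apply/orP; left; apply/eqP.
by apply: eq_bigr => al _; rewrite fineK.
Qed.
End MarsFunctional.

(** * Sub-Gaussian noise *)

Section Independence.
Context (disp : measure_display) (T : measurableType disp) (R : realType).
Variable P : probability T R.
Local Open Scope ereal_scope.

(** [c] plays the role of the mean of [h]. The product formula passes from indicators to simple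
    functions by linearity, then to nonnegative functions by monotone convergence. *)
Lemma integral_mul_indep (h : T -> R) (Y : {RV P >-> R}) (c : R) :
  measurable_fun setT h -> (forall w, (0 <= h w)%R) -> (0 <= c)%R ->
  (forall A, measurable A -> \int[P]_w (h w * \1_A (Y w))%:E = c%:E * P (Y @^-1` A)) ->
  forall f : R -> R, measurable_fun setT f -> (forall y, (0 <= f y)%R) ->
  \int[P]_w (h w * f (Y w))%:E = c%:E * \int[P]_w (f (Y w))%:E.
Proof.
move=> mh h0 c0 hA f mf f0.
have mY : measurable_fun setT Y by exact: measurable_funPT.
have mEf : measurable_fun setT (EFin \o f) by exact/measurable_EFinP.
have f0' y : setT y -> 0 <= (EFin \o f) y by move=> _; rewrite lee_fin.
pose g_ := nnsfun_approx measurableT mEf.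
pose g (m : nat) (y : R) : R := g_ m y.
have g0 m y : (0 <= g m y)%R by rewrite /g.
have mg m : measurable_fun setT (g m) by rewrite /g.
have mgY m : measurable_fun setT (fun w => g m (Y w)) by exact: measurableT_comp.
have gcvg y : (EFin \o g^~ y) @ \oo --> (f y)%:E by exact: (cvg_nnsfun_approx measurableT mEf f0').
have gnd y m k : (m <= k)%N -> (g m y <= g k y)%R by move=> mk; exact/lefP/nd_nnsfun_approx.
have simple m : \int[P]_w (h w * g m (Y w))%:E = c%:E * \int[P]_w (g m (Y w))%:E.
  have gE y : g m y = (\sum_(z \in range (g m)) z * \1_((g m) @^-1` [set z]) y)%R by rewrite /g fimfunE.
  have mI z : measurable ((g m) @^-1` [set z]) by exact: (measurable_sfunP (g_ m)).
  have mIY z : measurable_fun setT (fun w => \1_((g m) @^-1` [set z]) (Y w) : R).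
    by apply: measurableT_comp => //.
  have fin : finite_set (range (g m)) by exact: (fimfunP (g_ m)).
  have rg0 z : z \in fset_set (range (g m)) -> (0 <= z)%R.
    by rewrite in_fset_set // => /set_mem[y _ <-].
  have sumE (k : T -> R) : measurable_fun setT k -> (forall w, (0 <= k w)%R) ->
     \int[P]_w (k w * g m (Y w))%:E =
     \sum_(z <- fset_set (range (g m))) z%:E * \int[P]_w (k w * \1_((g m) @^-1` [set z]) (Y w))%:E.
    move=> mk k0.
    have mkI z : measurable_fun setT (fun w => (k w * \1_((g m) @^-1` [set z]) (Y w))%:E).
      by apply/measurable_EFinP; exact: measurable_funM.
    (* The weight [Num.max z 0] is [z] on the range of [g m] and makes every summand nonnegative,
       whatever [z]. *)
    transitivity (\int[P]_w \sum_(z <- fset_set (range (g m)))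
       (Num.max z 0%R)%:E * (k w * \1_((g m) @^-1` [set z]) (Y w))%:E).
      apply: eq_integral => w _; rewrite gE fsbig_finite // mulr_sumr -sumEFin.
      rewrite big_seq_cond [RHS]big_seq_cond; apply: eq_bigr => z; rewrite andbT => /rg0 z0.
      by rewrite (max_idPl z0) -EFinM mulrCA.
    rewrite ge0_integral_sum //; last 2 first.
    - by move=> z; exact: measurable_funeM.
    - by move=> z w _; rewrite -EFinM lee_fin mulr_ge0 ?mulr_ge0 ?le_max ?lexx ?orbT.
    rewrite big_seq_cond [RHS]big_seq_cond; apply: eq_bigr => z; rewrite andbT => /rg0 z0.
    rewrite ge0_integralZl_EFin ?(max_idPl z0) // => w _.
    by rewrite lee_fin mulr_ge0.
  rewrite sumE //.
  have -> : \int[P]_w (g m (Y w))%:E = \int[P]_w (cst 1%R w * g m (Y w))%:E.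
    by apply: eq_integral => w _; rewrite mul1r.
  rewrite sumE // big_seq_cond [in RHS]big_seq_cond ge0_sume_distrr; last first.
    move=> z; rewrite andbT => /rg0 z0; rewrite mule_ge0 ?lee_fin //.
    by apply: integral_ge0 => w _; rewrite lee_fin mulr_ge0.
  apply: eq_bigr => z; rewrite andbT => /rg0 z0.
  rewrite hA // muleCA; congr (_ * (_ * _)).
  under eq_integral do rewrite mul1r.
  rewrite (_ : (fun w => (\1_((g m) @^-1` [set z]) (Y w))%:E) =
     (fun w => (\1_(Y @^-1` ((g m) @^-1` [set z])) w)%:E)) //.
  by rewrite integral_indic ?setIT // -[X in measurable X]setTI; exact: mY.
have lim1 : (fun m => \int[P]_w (h w * g m (Y w))%:E) @ \oo --> \int[P]_w (h w * f (Y w))%:E.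
  have -> : \int[P]_w (h w * f (Y w))%:E = \int[P]_w limn (fun m => (h w * g m (Y w))%:E).
    apply: eq_integral => w _; apply/esym/cvg_lim => //.
    under eq_fun do rewrite EFinM.
    by rewrite EFinM; apply: cvgeZl => //; exact: gcvg.
  apply: cvg_monotone_convergence => //.
  - by move=> m; apply/measurable_EFinP; exact: measurable_funM.
  - by move=> m w _; rewrite lee_fin mulr_ge0.
  - by move=> w _ m k mk; rewrite lee_fin ler_wpM2l // gnd.
have lim2 : (fun m => \int[P]_w (g m (Y w))%:E) @ \oo --> \int[P]_w (f (Y w))%:E.
  have -> : \int[P]_w (f (Y w))%:E = \int[P]_w limn (fun m => (g m (Y w))%:E).
    by apply: eq_integral => w _; apply/esym/cvg_lim => //; exact: gcvg.
  apply: cvg_monotone_convergence => //.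
  - by move=> m; apply/measurable_EFinP.
  - by move=> m w _; rewrite lee_fin.
  - by move=> w _ m k mk; rewrite lee_fin gnd.
have lim3 := cvgeZl (isT : c%:E \is a fin_num) lim2.
rewrite (_ : (fun m => c%:E * _) = (fun m => \int[P]_w (h w * g m (Y w))%:E)) in lim3.
  exact: cvg_unique lim1 lim3.
by apply/funext => m; rewrite simple.
Qed.

End Independence.

Section SubGaussian.
Context (disp : measure_display) (T : measurableType disp) (R : realType).
Variable P : probability T R.
Local Open Scope ereal_scope.

Lemma integral_indic_comp (Y : {RV P >-> R}) (A : set R) : measurable A ->
  \int[P]_w (\1_A (Y w))%:E = P (Y @^-1` A).
Proof.
move=> mA; rewrite (_ : (fun w => (\1_A (Y w))%:E) = (fun w => (\1_(Y @^-1` A) w)%:E)) //.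
rewrite integral_indic ?setIT // -[X in measurable X]setTI.
exact: (measurable_funPT Y).
Qed.

(* Indicators are replaced by arbitrary functions one index at a time: [k] counts
   the indices where [F i] need not be an indicator. *)
Lemma integral_prod_indep (n : nat) (X : 'I_n -> {RV P >-> R}) (F : 'I_n -> R -> R) :
  mutually_independent X ->
  (forall i, measurable_fun setT (F i)) -> (forall i y, (0 <= F i y)%R) ->
  (forall i, \int[P]_w (F i (X i w))%:E < +oo) ->
  \int[P]_w (\prod_(i < n) F i (X i w))%:E = \prod_(i < n) \int[P]_w (F i (X i w))%:E.
Proof.
move=> indX; suff H k : forall F : 'I_n -> R -> R,
  (forall i : 'I_n, (k <= i)%N -> exists2 A, measurable A & F i = \1_A) ->
  (forall i, measurable_fun setT (F i)) -> (forall i y, (0 <= F i y)%R) ->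
  (forall i, \int[P]_w (F i (X i w))%:E < +oo) ->
  \int[P]_w (\prod_(i < n) F i (X i w))%:E = \prod_(i < n) \int[P]_w (F i (X i w))%:E.
  by apply: (H n F) => i; rewrite leqNgt ltn_ord.
elim: k => [|k IH] {}F FI mF F0 Ffin.
  have /choice[A AP] i : exists A, measurable A /\ F i = \1_A.
    by have [//|A mA FA] := FI i; exists A.
  rewrite (eq_bigr (fun i => P (X i @^-1` A i))); last first.
    by move=> i _; case: (AP i) => mA ->; exact: integral_indic_comp.
  have -> : \prod_(i < n) P (X i @^-1` A i)
    = \prod_(i in [set: 'I_n]%SET) P (X i @^-1` A i).
    by apply: eq_bigl => i; rewrite finset.in_setT.
  rewrite -indX; last by move=> i; case: (AP i).
  rewrite -[X in _ = P X]setIT -integral_indic //; last first.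
    apply: fin_bigcap_measurable => [|i _]; first exact: finite_finset.
    by rewrite -[X in measurable X]setTI; apply: (measurable_funPT (X i)) => //; case: (AP i).
  apply: eq_integral => w _; congr EFin.
  rewrite /indic; case: (boolP (w \in _)) => [/set_mem h|/negP h].
    rewrite big1 // => i _; case: (AP i) => mA ->.
    by rewrite indicE mem_set //; apply: (h i); rewrite /= finset.in_setT.
  have [i hi] : exists i, ~ A i (X i w).
    by apply/existsNP => h'; apply: h; apply/mem_set => i _; exact: h'.
  rewrite (bigD1 i) //=; case: (AP i) => mA ->.
  by rewrite indicE memNset // mul0r.
have [nk|kn] := leqP n k.
  by apply: IH => // i ki; have := ltn_ord i; rewrite ltnNge (leq_trans nk ki).
pose k0 := Ordinal kn.
have fin i : \int[P]_w (F i (X i w))%:E \is a fin_num.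
  by rewrite ge0_fin_numE ?Ffin //; apply: integral_ge0 => w _; rewrite lee_fin.
pose c := (\prod_(i < n | i != k0) fine (\int[P]_w (F i (X i w))%:E))%R.
have cE : \prod_(i < n | i != k0) \int[P]_w (F i (X i w))%:E = c%:E.
  by rewrite -prodEFin; apply: eq_bigr => i _; rewrite fineK.
have mFX i : measurable_fun setT (fun w => F i (X i w)).
  by apply: measurableT_comp => //; exact: measurable_funPT.
rewrite [RHS](bigD1 k0) //= cE muleC.
rewrite -(@integral_mul_indep _ _ _ _ (fun w => \prod_(i < n | i != k0) F i (X i w))%R) //.
- by apply: eq_integral => w _; rewrite (bigD1 k0) //= mulrC.
- rewrite (_ : (fun w => _) = (fun w => \prod_(i <- [seq i <- index_enum 'I_n | i != k0]) F i (X i w))%R).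
    by apply: measurable_prod => i _.
  by apply/funext => w; rewrite big_filter.
- by move=> w; apply: prodr_ge0.
- by apply: prodr_ge0 => i _; rewrite fine_ge0 //; apply: integral_ge0 => w _; rewrite lee_fin.
(* With an indicator at [k0], one index fewer is general, and the induction hypothesis gives the
   product formula on indicators. *)
- move=> A mA; pose G i : R -> R := if i == k0 then \1_A else F i.
  have Gk0 : G k0 = \1_A by rewrite /G eqxx.
  have Gk i : i != k0 -> G i = F i by rewrite /G => /negbTE ->.
  transitivity (\int[P]_w (\prod_(i < n) G i (X i w))%:E).
    apply: eq_integral => w _; rewrite [in RHS](bigD1 k0) //= Gk0 mulrC.
    by congr EFin; congr (_ * _)%R; apply: eq_bigr => i /Gk ->.
  rewrite IH.
  + rewrite (bigD1 k0) //= Gk0 -cE muleC integral_indic_comp //.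
    by congr (_ * _); apply: eq_bigr => i /Gk ->.
  + move=> i; rewrite leq_eqVlt => /orP[/eqP ki|ki].
      by exists A => //; rewrite /G (_ : i = k0) ?eqxx //; exact/val_inj.
    by rewrite /G; case: eqP => [E|_]; [exists A|exact: FI].
  + by move=> i; rewrite /G; case: eqP => // _; exact: measurable_indic.
  + by move=> i y; rewrite /G; case: eqP => // _; rewrite indicE.
  + move=> i; rewrite /G; case: eqP => // _; rewrite integral_indic_comp //.
    by rewrite (le_lt_trans (probability_le1 _ _)) ?ltry // -[X in measurable X]setTI;
      apply: (measurable_funPT (X i)).
Qed.

Lemma sub_gaussian_linear (n : nat) (X : 'I_n -> {RV P >-> R}) (sigma : R) (v : 'I_n -> R) :
  mutually_independent X -> (forall i, sub_gaussian sigma (X i)) ->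
  \int[P]_w (expR (\sum_(i < n) v i * X i w))%:E
    <= (expR (sigma ^+ 2 * (\sum_(i < n) v i ^+ 2) / 2))%:E.
Proof.
move=> indX sg.
have sg' i : \int[P]_w (expR (v i * X i w))%:E <= (expR (sigma ^+ 2 * v i ^+ 2 / 2))%:E.
  by have := sg i (v i); rewrite unlock.
under eq_integral do rewrite expR_sum.
rewrite (integral_prod_indep (F := fun i y => expR (v i * y))) //.
- rewrite mulr_sumr mulr_suml expR_sum -prodEFin.
  have fin i : \int[P]_w (expR (v i * X i w))%:E \is a fin_num.
    rewrite ge0_fin_numE; first by apply: le_lt_trans (sg' i) _; exact: ltry.
    by apply: integral_ge0 => w _; rewrite lee_fin expR_ge0.
  rewrite (eq_bigr (fun i => (fine (\int[P]_w (expR (v i * X i w))%:E))%:E)); last first.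
    by move=> i _; rewrite fineK.
  rewrite !prodEFin lee_fin; apply: ler_prod => i _.
  rewrite -!lee_fin fineK // sg' andbT.
  by apply: integral_ge0 => w _; rewrite lee_fin expR_ge0.
- by move=> i; apply: measurableT_comp => //; exact: measurable_expR.
- by move=> i; apply: le_lt_trans (sg' i) _; exact: ltry.
Qed.

End SubGaussian.

(** * Least squares on the design *)

Section Projection.
Variables (R : realType) (n : nat).

Lemma sqr_row_eq0 (v : 'rV[R]_n) : v *m v^T = 0 -> v = 0.
Proof.
move=> /matrixP /(_ 0 0); rewrite !mxE => /eqP.
rewrite psumr_eq0 => [/allP h|i _]; last by rewrite mxE -expr2 sqr_ge0.
apply/rowP => i; have := h i (mem_index_enum i).
by rewrite !mxE /= -expr2 sqrf_eq0 => /eqP.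
Qed.

Lemma gram_unit r (C : 'M[R]_(r, n)) : row_free C -> C *m C^T \in unitmx.
Proof.
move=> fC; rewrite -row_free_unit; apply/inj_row_free => v vC.
have : v *m C = 0.
  apply: sqr_row_eq0; rewrite trmx_mul mulmxA -(mulmxA v) vC mul0mx //.
by move/eqP; rewrite mulmx_free_eq0 // => /eqP.
Qed.

(** For a row basis [C] of [M], the projection is C^T (C C^T)^-1 C; by cyclicity its trace is the
    rank. *)
Lemma projection_mx m (M : 'M[R]_(m, n)) : exists p : 'M[R]_n,
  [/\ p^T = p, p *m p = p, M *m p = M & \tr p <= m%:R].
Proof.
have [r [C [fC MC rm]]] : exists r (C : 'M[R]_(r, n)),
    [/\ row_free C, (M <= C)%MS & (r <= m)%N].
  by exists (\rank M), (row_base M); rewrite row_base_free eq_row_base rank_leq_row.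
have uG := gram_unit fC.
exists (C^T *m invmx (C *m C^T) *m C).
have GT : (invmx (C *m C^T))^T = invmx (C *m C^T).
  by rewrite trmx_inv trmx_mul trmxK.
split.
- by rewrite !trmx_mul GT trmxK mulmxA.
- by rewrite !mulmxA -(mulmxA _ C C^T) mulmxKV // -(mulmxA _ (invmx _) _) ?mulmxA.
- have /submxP[X MX] := MC.
  by rewrite {1}MX !mulmxA -(mulmxA X) mulmxK // -MX.
- rewrite -mulmxA mxtrace_mulC -mulmxA mulVmx // mxtrace1.
  by rewrite ler_nat.
Qed.

(** The last clause bounds the mean square of the projected noise: for a symmetric idempotent matrix
    the sum of squared entries is the trace. *)
Lemma orthogonal_projection (I : finType) (D : pred I) (B : I -> 'I_n -> R) :
  exists p : 'I_n -> 'I_n -> R,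
  [/\ forall xi a, D a -> \sum_i (xi i - \sum_j p i j * xi j) * B a i = 0,
      forall xi b, \sum_i (xi i - \sum_j p i j * xi j) * b i
                   = \sum_i xi i * (b i - \sum_j p i j * b j),
      forall b, \sum_i (b i - \sum_j p i j * b j) ^+ 2 <= \sum_i b i ^+ 2
    & \sum_i \sum_j p i j ^+ 2 <= #|D|%:R].
Proof.
have [p [pT pp Mp trp]] := projection_mx (\matrix_(a < #|D|, j < n) B (enum_val a) j).
have sym i j : p i j = p j i by rewrite -{1}pT mxE.
have idem i k : \sum_j p i j * p j k = p i k by have := congr1 (fun M => fun_of_matrix M i k) pp; rewrite mxE.
have adj xi b : \sum_i (xi i - \sum_j p i j * xi j) * b i
    = \sum_i xi i * (b i - \sum_j p i j * b j).
  under eq_bigr do rewrite mulrBl.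
  under [RHS]eq_bigr do rewrite mulrBr.
  rewrite !sumrB; congr (_ - _).
  under eq_bigr do rewrite mulr_suml.
  rewrite exchange_big /=; apply: eq_bigr => j _; rewrite mulr_sumr.
  by apply: eq_bigr => i _; rewrite sym; ring.
exists (fun i j => p i j); split => //.
- move=> xi a Da; rewrite adj big1 // => i _.
  have E : \sum_j B a j * p j i = B a i.
    have := congr1 (fun M => fun_of_matrix M (enum_rank_in Da a) i) Mp.
    rewrite !mxE enum_rankK_in // => <-.
    by apply: eq_bigr => j _; rewrite !mxE enum_rankK_in.
  rewrite -[X in X - _]E -sumrB big1 ?mulr0 // => j _.
  by rewrite sym mulrC subrr.
- move=> b; pose q i := \sum_j p i j * b j.
  have qq i : \sum_j p i j * q j = q i.
    rewrite /q; under eq_bigr do rewrite mulr_sumr.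
    rewrite exchange_big /=; apply: eq_bigr => k _.
    by under eq_bigr do rewrite mulrA; rewrite -mulr_suml idem.
  have E : \sum_i (b i - q i) * q i = 0.
    rewrite (adj b q) big1 // => i _; by rewrite qq subrr mulr0.
  have -> : \sum_i b i ^+ 2 = \sum_i (b i - q i) ^+ 2 + \sum_i q i ^+ 2 + 2 * \sum_i (b i - q i) * q i.
    by rewrite mulr_sumr -!big_split; apply: eq_bigr => i _ /=; ring.
  by rewrite E mulr0 addr0 lerDl sumr_ge0 // => i _; exact: sqr_ge0.
- rewrite (le_trans _ trp) // le_eqVlt; apply/orP; left; apply/eqP.
  apply: eq_bigr => i _; rewrite -[RHS]idem; apply: eq_bigr => j _.
  by rewrite expr2 {2}sym.
Qed.
End Projection.

(** * Means and maxima of sub-Gaussian linear forms *)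

Section MeanBounds.
Context (disp : measure_display) (T : measurableType disp) (R : realType).
Variable P : probability T R.

(** Measurability and nonnegativity are bundled so that bounds can be added and scaled without
    integrability conditions. *)
Definition mean_le (f : T -> R) (b : R) : Prop :=
  [/\ measurable_fun setT f, forall w, 0 <= f w
    & (\int[P]_w (f w)%:E <= b%:E)%E].

Lemma mean_le_cst b : 0 <= b -> mean_le (fun=> b) b.
Proof.
move=> b0; split; [exact: measurable_cst|by []|].
rewrite integral_cst // -[X in (_ <= X)%E]mule1.
by apply: lee_wpmul2l; rewrite ?lee_fin //; exact: probability_le1.
Qed.

Lemma mean_leD f g a b : mean_le f a -> mean_le g b -> mean_le (fun w => f w + g w) (a + b).
Proof.
move=> [mf f0 fa] [mg g0 gb]; split; first exact: measurable_funD.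
  by move=> w; rewrite addr_ge0.
under eq_integral do rewrite EFinD.
rewrite ge0_integralD //; first by rewrite EFinD leeD.
- by move=> w _; rewrite lee_fin.
- exact/measurable_EFinP.
- by move=> w _; rewrite lee_fin.
- exact/measurable_EFinP.
Qed.

Lemma mean_leZ k f a : 0 <= k -> mean_le f a -> mean_le (fun w => k * f w) (k * a).
Proof.
move=> k0 [mf f0 fa]; split; first exact: measurable_funM.
  by move=> w; rewrite mulr_ge0.
under eq_integral do rewrite EFinM.
rewrite ge0_integralZl_EFin // ?EFinM ?lee_wpmul2l ?lee_fin //.
- by move=> w _; rewrite lee_fin.
- exact/measurable_EFinP.
Qed.

Lemma mean_le_sum (I : Type) (r : seq I) (Q : pred I) (f : I -> T -> R) (a : I -> R) :
  (forall i, Q i -> mean_le (f i) (a i)) ->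
  mean_le (fun w => \sum_(i <- r | Q i) f i w) (\sum_(i <- r | Q i) a i).
Proof.
move=> fa; elim: r => [|i r IH].
  rewrite big_nil; rewrite (_ : (fun w => _) = fun=> 0); first exact: mean_le_cst.
  by apply/funext => w; rewrite big_nil.
rewrite big_cons; case: ifPn => Qi.
  rewrite (_ : (fun w => _) = fun w => f i w + \sum_(j <- r | Q j) f j w).
    by apply: mean_leD => //; exact: fa.
  by apply/funext => w; rewrite big_cons Qi.
rewrite (_ : (fun w => _) = fun w => \sum_(j <- r | Q j) f j w) //.
by apply/funext => w; rewrite big_cons (negbTE Qi).
Qed.

Lemma mean_le_weak f a b : a <= b -> mean_le f a -> mean_le f b.
Proof. by move=> ab [mf f0 fa]; split => //; rewrite (le_trans fa) ?lee_fin. Qed.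

(* The estimator, hence [f], may fail to be measurable; monotonicity survives
   because the integral of a nonnegative function is a supremum over the simple
   functions below it. *)
Lemma integral_le_mean (f g : T -> R) b : (forall w, 0 <= f w <= g w) -> mean_le g b ->
  (\int[P]_w (f w)%:E <= b%:E)%E.
Proof.
move=> fg [mg g0 gb]; apply: le_trans gb.
rewrite !ge0_integralTE; last 2 first.
- by move=> w; rewrite lee_fin.
- by move=> w; rewrite lee_fin; case/andP: (fg w).
apply: le_ereal_sup => _ [h hf <-]; exists h => // w.
by rewrite (le_trans (hf w)) // lee_fin; case/andP: (fg w).
Qed.

Lemma mean_le_mono (f g : T -> R) b : measurable_fun setT f -> (forall w, 0 <= f w <= g w) ->
  mean_le g b -> mean_le f b.
Proof.
move=> mf fg gb; split => //; first by move=> w; case/andP: (fg w).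
exact: integral_le_mean gb.
Qed.

Variables (n : nat) (X : 'I_n -> {RV P >-> R}) (sigma : R).
Hypotheses (sigma0 : 0 < sigma) (indX : mutually_independent X).
Hypothesis sg : forall i, sub_gaussian sigma (X i).

Let lin (v : 'I_n -> R) w := \sum_(i < n) v i * X i w.

Lemma measurable_lin v : measurable_fun setT (lin v).
Proof.
apply: measurable_sum => i; apply: measurable_funM => //; exact: measurable_funPT.
Qed.

Lemma mean_le_exp (v : 'I_n -> R) (l K : R) : \sum_(i < n) v i ^+ 2 <= K ->
  mean_le (fun w => expR (l * lin v w)) (expR (sigma ^+ 2 * (l ^+ 2 * K) / 2)).
Proof.
move=> vK; split.
- by apply: measurableT_comp => //; apply: measurable_funM => //; exact: measurable_lin.
- by move=> w; exact: expR_ge0.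
have := sub_gaussian_linear (fun i => l * v i) indX sg.
under eq_integral do under eq_bigr do rewrite -mulrA.
under eq_integral do rewrite -mulr_sumr.
move/le_trans; apply; rewrite lee_fin ler_expR ler_wpM2r ?invr_ge0 //.
rewrite ler_wpM2l ?sqr_ge0 //; under eq_bigr do rewrite exprMn.
by rewrite -mulr_sumr ler_wpM2l ?sqr_ge0.
Qed.

Lemma mean_le_exp2 (v : 'I_n -> R) (l K : R) : \sum_(i < n) v i ^+ 2 <= K ->
  mean_le (fun w => expR (l * lin v w) + expR (- l * lin v w))
          (2 * expR (sigma ^+ 2 * (l ^+ 2 * K) / 2)).
Proof.
move=> vK; rewrite mulrDl mul1r; apply: mean_leD; first exact: mean_le_exp.
by have := mean_le_exp (- l) vK; rewrite sqrrN.
Qed.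

Lemma sqr_le_exp2 (z : R) : z ^+ 2 <= 2 * (expR z + expR (- z)).
Proof.
have h (y : R) : 0 <= y -> y ^+ 2 <= 2 * expR y.
  by move=> y0; have := expR_ge1Dxn 1 y0; rewrite (_ : 2`!%:R = 2) //; lra.
have p1 := expR_ge0 z; have p2 := expR_ge0 (- z).
case: (leP 0 z) => z0; first by have := h z z0; lra.
by have := h (- z) ltac:(lra); rewrite sqrrN; lra.
Qed.

(** [sqr_le_exp2] is applied to the form divided by sigma |v|, where each of the two exponential
    moments is at most [expR (1 / 2)]. The case v = 0 is apart because of this division. *)
Lemma mean_le_sqr (v : 'I_n -> R) :
  mean_le (fun w => lin v w ^+ 2) (4 * expR (1 / 2) * sigma ^+ 2 * \sum_(i < n) v i ^+ 2).
Proof.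
set K := \sum_(i < n) v i ^+ 2.
have mv : measurable_fun setT (fun w => lin v w ^+ 2).
  by apply: measurable_funX; exact: measurable_lin.
have [K0|K0] := eqVneq K 0.
  have v0 i : v i = 0.
    move: K0 => /eqP; rewrite psumr_eq0 => [/allP /(_ i (mem_index_enum i))|j _]; last exact: sqr_ge0.
    by rewrite /= sqrf_eq0 => /eqP.
  rewrite K0 mulr0 (_ : (fun w => _) = fun=> 0); first exact: mean_le_cst.
  by apply/funext => w; rewrite /lin big1 ?expr0n // => i _; rewrite v0 mul0r.
have {}K0 : 0 < K by rewrite lt_neqAle eq_sym K0 sumr_ge0 // => i _; exact: sqr_ge0.
set t := Num.sqrt K; have t0 : 0 < t by rewrite sqrtr_gt0.
have tt : t ^+ 2 = K by rewrite sqr_sqrtr ?ltW.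
have st0 : 0 < sigma * t by rewrite mulr_gt0.
apply: (@mean_le_mono _ (fun w => 2 * (sigma * t) ^+ 2 *
   (expR ((sigma * t)^-1 * lin v w) + expR (- (sigma * t)^-1 * lin v w)))) => //.
  move=> w; rewrite sqr_ge0 /= mulrAC -[_ * _ * _]mulrC -ler_pdivrMl ?exprn_gt0 //.
  by rewrite mulNr -exprVn -exprMn sqr_le_exp2.
apply: (mean_le_weak _ (mean_leZ _ (mean_le_exp2 _ (lexx K)))); last by rewrite mulr_ge0 ?sqr_ge0.
rewrite exprVn exprMn tt.
have -> : sigma ^+ 2 * ((sigma ^+ 2 * K)^-1 * K) / 2 = 1 / 2 by field; rewrite !gt_eqF.
by rewrite le_eqVlt; apply/orP; left; apply/eqP; ring.
Qed.

(* From y <= c + exp (y - c); summing the exponentials makes the right-hand side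
   independent of a. *)
Lemma sup_le_exp (I : finType) (D : pred I) (z : I -> R) (l c : R) a :
  0 < l -> D a ->
  `|z a| <= (c + expR (- c) * \sum_(i | D i) (expR (l * z i) + expR (- l * z i))) / l.
Proof.
move=> l0 Da; rewrite ler_pdivlMr // mulrC -{1}(gtr0_norm l0) -normrM.
apply: (@le_trans _ _ (c + expR (- c) * (expR (l * z a) + expR (- l * z a)))).
  have h (y : R) : y <= c + expR (- c) * expR y.
    rewrite -expRD; have := expR_ge1Dx (- c + y); lra.
  have h1 := h (l * z a); have h2 := h (- l * z a).
  have e1 : 0 <= expR (- c) * expR (l * z a) by rewrite mulr_ge0 ?expR_ge0.
  have e2 : 0 <= expR (- c) * expR (- l * z a) by rewrite mulr_ge0 ?expR_ge0.
  rewrite ler_norml mulrDr; set q := _ * expR (- l * z a) in h2 e2 *.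
  by rewrite mulNr in h2; apply/andP; split; lra.
rewrite lerD2l ler_wpM2l ?expR_ge0 // (bigD1 a) //= lerDl sumr_ge0 // => i _.
Qed.

(** The maximal inequality: [expR c] dominates the sum of all exponential moments, so the
    exponential part of the majorant has mean at most 1. *)
Lemma mean_le_sup (I : finType) (D : pred I) (v : I -> 'I_n -> R) (l c K : R) :
  0 < l -> 0 <= c -> (forall a, D a -> \sum_(i < n) v a i ^+ 2 <= K) ->
  2 * #|D|%:R * expR (sigma ^+ 2 * (l ^+ 2 * K) / 2) <= expR c ->
  mean_le (fun w => (c + expR (- c) *
     \sum_(a | D a) (expR (l * lin (v a) w) + expR (- l * lin (v a) w))) / l)
   ((c + 1) / l).
Proof.
move=> l0 c0 vK h.
have m1 : mean_le (fun w => \sum_(a | D a) (expR (l * lin (v a) w) + expR (- l * lin (v a) w)))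
   (\sum_(a | D a) (2 * expR (sigma ^+ 2 * (l ^+ 2 * K) / 2))).
  by apply: mean_le_sum => a Da; exact/mean_le_exp2/vK.
rewrite (_ : (fun w => _) = fun w => l^-1 * (c + expR (- c) *
     \sum_(a | D a) (expR (l * lin (v a) w) + expR (- l * lin (v a) w)))); last first.
  by apply/funext => w; rewrite mulrC.
rewrite [_ / l]mulrC; apply: mean_leZ; first by rewrite invr_ge0 ltW.
apply: mean_leD; first exact: mean_le_cst.
apply: (mean_le_weak _ (mean_leZ (expR_ge0 _) m1)).
rewrite sumr_const -[X in _ * X <= _]mulr_natr expRN ler_pdivrMl ?expR_gt0 // mulr1.
by rewrite mulrAC.
Qed.

End MeanBounds.

(** * Summation over the levels *)

Section LevelSums.
Variable R : realType.

(** Powers of [q] express 2^(-3m/2) as [q ^+ (3 * m)], with natural exponents. *)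
Let q : R := Num.sqrt 2^-1.

Lemma sqrt_half_sqr : q ^+ 2 = 2^-1.
Proof. by rewrite sqr_sqrtr ?invr_ge0. Qed.

Lemma sqrt_half_gt0 : 0 < q.
Proof. by rewrite sqrtr_gt0 invr_gt0. Qed.

Lemma sqrt_half_lt1 : q < 1.
Proof.
have := sqrt_half_sqr; have := sqrt_half_gt0; rewrite expr2 => q0 qq.
by rewrite ltNge; apply/negP => h; nra.
Qed.

(** With a the integer part of (l + 1) / d, l + 1 <= d (a + 1) <= d 2^a and a d <= l + 1. *)
Lemma succ_exp_le d l : (0 < d)%N -> (l.+1 ^ d <= 2 * d ^ d * 2 ^ l)%N.
Proof.
move=> d0; set a := (l.+1 %/ d)%N.
have h1 : (l.+1 <= d * a.+1)%N by have := divn_eq l.+1 d; have := ltn_pmod l.+1 d0; rewrite -/a; nia.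
have h2 : (a.+1 <= 2 ^ a)%N by exact: ltn_expl.
have h3 : (a * d <= l.+1)%N by exact: leq_trunc_div.
rewrite (leq_trans (n := (d * 2 ^ a) ^ d)) ?leq_exp2r //.
  by rewrite (leq_trans h1) // leq_mul2l h2 orbT.
rewrite expnMn -expnM mulnAC -expnS mulnC leq_mul2r leq_pexp2l ?orbT //.
Qed.

(** Keeping the remainder [q ^+ (L - M)] makes the bound inductive; for [L <= M] truncated
    subtraction makes it 1 and the sum is empty. *)
Lemma geometric_tail (M L : nat) :
  (1 - q) * \sum_(m < L | (M < m)%N) q ^+ (m - M) + q ^+ (L - M) <= 1.
Proof.
have q0 := sqrt_half_gt0; have q1 := sqrt_half_lt1.
elim: L => [|L IH]; first by rewrite big_ord0 mulr0 add0r sub0n expr0.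
rewrite big_mkcond big_ord_recr -big_mkcond /=.
case: ltnP => h.
  by rewrite subSn 1?ltnW // exprS mulrDr; apply: le_trans IH; lra.
rewrite addr0; apply: le_trans IH; rewrite lerD2l (eqnP h) expr0.
by rewrite exprn_ile1 ?ltW.
Qed.

(** For m = M + l, m + 1 <= (M + 1)(l + 1) separates the polynomial factors. Of q^(3l) = 2^-l q^l,
    the part 2^-l absorbs (l + 1)^s and q^l is left for the geometric series. *)
Lemma level_tail_le (d s M L : nat) : (1 <= s <= d)%N ->
  \sum_(m < L | (M < m)%N) m.+1%:R ^+ s.-1 * Num.sqrt m.+1%:R * q ^+ (3 * m)
  <= (2 * d ^ d)%:R / (1 - q) * (M.+1%:R ^+ s.-1 * Num.sqrt M.+1%:R * q ^+ (3 * M)).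
Proof.
move=> /andP[s1 sd]; have d0 : (0 < d)%N by exact: leq_trans sd.
have q0 := sqrt_half_gt0; have q1 := sqrt_half_lt1; have qq := sqrt_half_sqr.
set A := _ * _ * q ^+ (3 * M); have A0 : 0 <= A.
  by rewrite !mulr_ge0 ?exprn_ge0 ?sqrtr_ge0 ?ltW.
apply: (@le_trans _ _ (\sum_(m < L | (M < m)%N) (2 * d ^ d)%:R * A * q ^+ (m - M))).
  apply: ler_sum => m Mm; set l := (m - M)%N.
  have mE : nat_of_ord m = (M + l)%N by rewrite /l subnKC // ltnW.
  have h1 : (m.+1 <= M.+1 * l.+1)%N by rewrite mE; nia.
  have h1r : m.+1%:R <= M.+1%:R * l.+1%:R :> R by rewrite -natrM ler_nat.
  have hs : Num.sqrt m.+1%:R <= Num.sqrt M.+1%:R * l.+1%:R :> R.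
    rewrite (le_trans (ler_wsqrtr h1r)) // sqrtrM // ler_wpM2l ?sqrtr_ge0 //.
    rewrite -[X in _ <= X]ger0_norm // -sqrtr_sqr ler_wsqrtr //.
    by rewrite expr2 ler_peMl // ler1n.
  have hp : m.+1%:R ^+ s.-1 <= M.+1%:R ^+ s.-1 * l.+1%:R ^+ s.-1 :> R.
    by rewrite -exprMn lerXn2r // nnegrE.
  have hl : l.+1%:R ^+ s <= (2 * d ^ d)%:R * 2 ^+ l :> R.
    rewrite -!natrX -natrM ler_nat (leq_trans (leq_pexp2l _ sd)) //.
    exact: succ_exp_le.
  have q3 : q ^+ (3 * m) = q ^+ (3 * M) * (2 ^- l * q ^+ l).
    rewrite mE mulnDr exprD; congr (_ * _).
    by rewrite -exprVn -qq -exprM -exprD addnC -mulSn.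
  have ql : 0 < q ^+ l by rewrite exprn_gt0.
  rewrite q3 /A; have qM : 0 < q ^+ (3 * M) by rewrite exprn_gt0.
  apply: (@le_trans _ _ ((M.+1%:R ^+ s.-1 * l.+1%:R ^+ s.-1) * (Num.sqrt M.+1%:R * l.+1%:R)
     * (q ^+ (3 * M) * (2 ^- l * q ^+ l)))).
    apply: ler_wpM2r; first by rewrite !mulr_ge0 ?invr_ge0 ?exprn_ge0 ?ltW.
    by apply: ler_pM => //; rewrite ?exprn_ge0 ?sqrtr_ge0.
  have -> : M.+1%:R ^+ s.-1 * l.+1%:R ^+ s.-1 * (Num.sqrt M.+1%:R * l.+1%:R) *
     (q ^+ (3 * M) * (2 ^- l * q ^+ l)) =
     l.+1%:R ^+ s * (M.+1%:R ^+ s.-1 * Num.sqrt M.+1%:R * q ^+ (3 * M) * (2 ^- l * q ^+ l)) :> R.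
    by rewrite -[in RHS](prednK s1) exprSr; ring.
  rewrite (le_trans (ler_wpM2r _ hl)) //.
    by rewrite !mulr_ge0 ?invr_ge0 ?exprn_ge0 ?sqrtr_ge0 ?ltW.
  rewrite le_eqVlt; apply/orP; left; apply/eqP; field.
  by rewrite expf_neq0.
rewrite -mulr_sumr -mulrA -[X in _ <= X]mulrA ler_wpM2l //.
rewrite mulrC ler_wpM2r // -[X in _ <= X]div1r ler_pdivlMr ?subr_gt0 // mulrC.
have := geometric_tail M L; have : 0 < q ^+ (L - M) by rewrite exprn_gt0.
lra.
Qed.

Lemma level_head_le (s M : nat) :
  (\sum_(m < M.+1) m.+1 ^ s * 2 ^ m <= M.+1 ^ s * 2 ^ M.+1)%N.
Proof.
apply: (@leq_trans (\sum_(m < M.+1) M.+1 ^ s * 2 ^ m)).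
  apply: leq_sum => m _; rewrite leq_mul2r; apply/orP; right.
  by case: (s) => [|k]; rewrite ?expn0 ?leq_exp2r.
rewrite -big_distrr /= leq_mul2l; apply/orP; right.
elim: M => [|M IH]; first by rewrite big_ord1.
by rewrite big_ord_recr /= (leq_trans (leq_add IH (leqnn _))) // addnn -mul2n -expnS.
Qed.

End LevelSums.

(** * Inequalities holding at each outcome *)

Section Deterministic.
Variables (R : realType) (n : nat).

Lemma least_squares_basic (y g h : 'I_n -> R) :
  \sum_i (y i - g i) ^+ 2 <= \sum_i (y i - h i) ^+ 2 ->
  \sum_i (g i - h i) ^+ 2 <= 2 * \sum_i (y i - h i) * (g i - h i).
Proof.
move=> H; rewrite -subr_ge0.
rewrite (_ : _ - _ = \sum_i (y i - h i) ^+ 2 - \sum_i (y i - g i) ^+ 2) ?subr_ge0 //.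
by rewrite mulr_sumr -!sumrB; apply: eq_bigr => i _; ring.
Qed.

(** By 2 <z, D> <= 2 |z|^2 + |D|^2 / 2, half of |D|^2 is absorbed on the left. *)
Lemma split_noise_le (xi z D : 'I_n -> R) :
  \sum_i D i ^+ 2 <= 2 * \sum_i xi i * D i ->
  \sum_i D i ^+ 2 <= 4 * \sum_i z i ^+ 2 + 4 * `|\sum_i (xi i - z i) * D i|.
Proof.
move=> H.
have E : \sum_i xi i * D i = \sum_i z i * D i + \sum_i (xi i - z i) * D i.
  by rewrite -big_split /=; apply: eq_bigr => i _; ring.
have F : 4 * \sum_i z i * D i <= 4 * \sum_i z i ^+ 2 + \sum_i D i ^+ 2.
  rewrite !mulr_sumr -big_split /=; apply: ler_sum => i _.
  have := sqr_ge0 (2 * z i - D i); rewrite !expr2; nra.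
have := ler_norm (\sum_i (xi i - z i) * D i); rewrite E in H; lra.
Qed.

(** On each level above [M], the l^1 norm of the coefficients is paired with the maximum of the
    functional; the lower levels are annihilated by [eta]. *)
Lemma dictionary_functional_le (J : finType) (D : pred J) (lev : J -> nat)
    (B : J -> 'I_n -> R) (c : J -> R) (eta f : 'I_n -> R) (W Z : nat -> R) (M L : nat) :
  (forall i, f i = \sum_(j | D j) c j * B j i) ->
  (forall m, \sum_(j | D j && (lev j == m)) `|c j| <= W m) ->
  (forall j, D j -> (lev j < L)%N) ->
  (forall j, D j -> (lev j <= M)%N -> \sum_i eta i * B j i = 0) ->
  (forall j, D j -> (M < lev j)%N -> `|\sum_i eta i * B j i| <= Z (lev j)) ->
  (forall m, 0 <= Z m) ->
  `|\sum_i eta i * f i| <= \sum_(m < L | (M < m)%N) W m * Z m.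
Proof.
move=> fE cW levL eta0 etaZ Z0.
have -> : \sum_i eta i * f i = \sum_(j | D j) c j * \sum_i eta i * B j i.
  under eq_bigr do rewrite fE mulr_sumr.
  rewrite exchange_big /=; apply: eq_bigr => j _; rewrite mulr_sumr.
  by apply: eq_bigr => i _; ring.
rewrite (le_trans (ler_norm_sum _ _ _)) //.
case: L levL => [|L] levL.
  by rewrite big_ord0 big1 // => j /levL.
rewrite (partition_big (fun j => inord (lev j) : 'I_L.+1) xpredT) //= [X in _ <= X]big_mkcond /=.
apply: ler_sum => m _; case: ifP => Mm.
  apply: (@le_trans _ _ (\sum_(j | D j && (lev j == m)) `|c j| * Z m)); last first.
    by rewrite -mulr_suml ler_wpM2r.
  rewrite (eq_bigl (fun j => D j && (lev j == m))) => [|j]; last first.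
    by case: (boolP (D j)) => //= Dj; rewrite -val_eqE /= inordK // levL.
  apply: ler_sum => j /andP[Dj /eqP jm]; rewrite normrM ler_wpM2l //.
  by rewrite -jm etaZ // jm.
rewrite big1 // => j /andP[Dj /eqP/(congr1 val) /=]; rewrite inordK ?levL // => jm.
by rewrite eta0 ?mulr0 ?normr0 // jm leqNgt Mm.
Qed.

End Deterministic.

(** On the class the set under [xget] is nonempty, so the value is the variation of an actual
    representation. *)
Lemma Vmars_represented (R : realType) (d s : nat) (f : d.-tuple R -> R) (V : R) :
  mars_class s f -> (Vmars s f <= V%:E)%E ->
  exists a0 nu, mars_represents s f a0 nu /\ (mars_variation s nu <= V%:E)%E.
Proof.
move=> [a [nu rep]]; rewrite /Vmars; case: xgetP => [v -> [a' [nu' [rep' ->]]] ? |nov].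
  by exists a', nu'.
by case: (nov (mars_variation s nu)); exists a, nu.
Qed.

Lemma succ_add_le_mul d m : ((d + m).+1 <= d.+1 * m.+1)%N.
Proof. by rewrite mulSn mulnS; lia. Qed.

(** * The risk bound *)

Lemma risk_level_bound (R : realType) (rho : R) (d : nat) : 0 < rho ->
  exists2 C : R, 0 < C &
  forall (s : nat) (V sigma : R),
    (1 <= s <= d)%N -> 0 < V -> 0 < sigma ->
  forall (n : nat) (N : 'I_d -> nat) (u : 'I_d -> nat -> R)
      (x : 'I_n -> d.-tuple R),
    lattice_design rho N u x ->
  forall (disp : measure_display) (T : measurableType disp)
      (P : probability T R) (xi : 'I_n -> {RV P >-> R})
      (fstar : d.-tuple R -> R) (y : 'I_n -> T -> R),
    mutually_independent xi ->
    (forall i, sub_gaussian sigma (xi i)) ->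
    (forall i w, y i w = fstar (x i) + xi i w) ->
    mars_class s fstar ->
    (Vmars s fstar <= V%:E)%E ->
  forall fhat : T -> d.-tuple R -> R,
    (forall w, is_mars_estimator s V x (fun i => y i w) (fhat w)) ->
  forall M : nat,
    (risk P x fhat fstar <=
     (C * (sigma ^+ 2 / n%:R) * (2 ^+ M * M.+1%:R ^+ s.-1)
      + C * (sigma * V / Num.sqrt n%:R)
        * (M.+1%:R ^+ s.-1 * Num.sqrt M.+1%:R * Num.sqrt 2^-1 ^+ (3 * M)))%:E)%E.
Proof.
move=> rho0; pose C0 : R := (4 / rho + 4) ^+ d.
have C00 : 0 < C0 by rewrite exprn_gt0 // addr_gt0 ?divr_gt0.
pose q : R := Num.sqrt 2^-1.
have q0 : 0 < q := sqrt_half_gt0 R; have q1 : q < 1 := sqrt_half_lt1 R.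
have qq : q ^+ 2 = 2^-1 := sqrt_half_sqr R.
(* In [C1], 16 is 4 from [split_noise_le] times 4 from [mean_le_sqr], and the rest counts the
   vectors up to level [M]. [C2] collects the coefficients, the maxima and the tail series. *)
pose C1 : R := 16 * expR (1 / 2) * (2 * 2 ^+ d).
pose C2 : R := 8 * (4 ^+ d * ((2 * d + 4)%:R * Num.sqrt C0) * ((2 * d ^ d)%:R / (1 - q))).
have C10 : 0 < C1 by rewrite !mulr_gt0 ?expR_gt0 ?exprn_gt0.
have C20 : 0 <= C2.
  by rewrite !mulr_ge0 ?exprn_ge0 ?sqrtr_ge0 ?invr_ge0 // subr_ge0 ltW.
exists (C1 + C2); first by rewrite ltr_wpDr.
move=> s V sigma sd V0 sigma0 n N u x lat disp T P xi fstar y indX sg yE fsM fsV fhat est M.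
have [s1 sd'] := andP sd.
have n0 : 0 < n%:R :> R.
  rewrite (lattice_prod_natr lat) prodr_gt0 // => k _.
  by case: (lattice_spaced lat k) => N2 _ _ _ _; rewrite ltr0n; lia.
have xcube i : cube (x i).
  move=> j; have [l lN ->] := lattice_mem lat i j.
  exact: (spaced_itv rho0 (lattice_spaced lat j)).
have [J [D [lev [B [cardJ normB atom0 atomJ]]]]] := multiscale_dictionary s rho0 lat.
pose L := (\max_(j | D j) lev j).+1.
have levL j : D j -> (lev j < L)%N by move=> Dj; rewrite ltnS (@leq_bigmax_cond _ D).
pose DM := [pred j | D j && (lev j <= M)%N].
have [p [orth adj contr frob]] := orthogonal_projection DM B.
pose v j i := B j i - \sum_k p i k * B j k.
pose lin (a : 'I_n -> R) w := \sum_i a i * xi i w.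
pose z w i := lin (p i) w.
pose K m : R := C0 * n%:R * 2 ^- m.
have K0 m : 0 < K m by rewrite !mulr_gt0 // invr_gt0 exprn_gt0.
(* With this [l m] the exponential moments are at most exp((m + 1) / 2). The logarithm of 2 * 2^d (m
   + 1)^(s-1) 2^m, the cardinality factor, is also linear in m + 1, and [c m] dominates the
   total. *)
pose l m : R := Num.sqrt m.+1%:R / (sigma * Num.sqrt (K m)).
have l0 m : 0 < l m by rewrite divr_gt0 ?mulr_gt0 ?sqrtr_gt0.
pose c m : R := (2 * d + 3)%:R * m.+1%:R.
have c0 m : 0 <= c m by rewrite mulr_ge0.
pose W m : R := 4 ^+ d * m.+1%:R ^+ s.-1 * 2 ^- m.
have W0 m : 0 <= W m by rewrite !mulr_ge0 ?invr_ge0 ?exprn_ge0.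
pose Dm m := [pred j | D j && (lev j == m)].
pose Z m w := (c m + expR (- c m) *
     \sum_(a | Dm m a) (expR (l m * lin (v a) w) + expR (- l m * lin (v a) w))) / l m.
have Z0 m w : 0 <= Z m w.
  apply: divr_ge0; last exact: ltW (l0 m).
  apply: addr_ge0 => //; apply: mulr_ge0; first exact: expR_ge0.
  by apply: sumr_ge0 => a _; rewrite addr_ge0 ?expR_ge0.
(* The factor 8 V is 4 (V + V): the functional is bounded separately at the estimator and at
   [fstar]. *)
pose G w := 4 * \sum_i z w i ^+ 2 + 8 * V * \sum_(m < L | (M < m)%N) W m * Z m w.
have functional w f : mars_class s f -> (Vmars s f <= V%:E)%E ->
    `|\sum_i (xi i w - z w i) * f (x i)| <= (\sum_(m < L | (M < m)%N) W m * Z m w) * V.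
  move=> fM fV; have [a0 [nu [rep nuV]]] := Vmars_represented fM fV.
  have low j : D j -> (lev j <= M)%N -> \sum_i (xi i w - z w i) * B j i = 0.
    by move=> Dj jM; apply: orth; rewrite inE Dj.
  under eq_bigr do rewrite rep //.
  apply: (mars_functional_le a0 xcube) nuV.
  - by apply: sumr_ge0 => m _; exact: mulr_ge0.
  (* The constant vector is the empty product, a dictionary vector of level 0. *)
  - have [|j [Dj j0] Bj] := atom0 finset.set0; first by rewrite cards0.
    rewrite -[RHS](low j Dj); last by rewrite j0.
    by apply: eq_bigr => i _; rewrite Bj finset.big_set0 mulr1.
  - move=> al als; have [j [Dj j0] Bj] := atom0 al als.
    rewrite -[RHS](low j Dj); last by rewrite j0.
    by apply: eq_bigr => i _; rewrite Bj.
  - move=> al t als t01; have [cf fE cW] := atomJ al t als t01.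
    apply: (dictionary_functional_le (B := B) (eta := fun i => xi i w - z w i)
      (Z := fun m => Z m w) fE cW levL low) => // j Dj _.
    rewrite adj (_ : \sum_i _ = lin (v j) w); last by apply: eq_bigr => i _; rewrite mulrC.
    apply: (sup_le_exp (D := Dm (lev j)) (fun a => lin (v a) w)) => //.
    by rewrite inE Dj eqxx.
have point w : 0 <= \sum_i (fhat w (x i) - fstar (x i)) ^+ 2 <= G w.
  have [fhM fhV fmin] := est w.
  rewrite sumr_ge0 /=; last by move=> i _; exact: sqr_ge0.
  have H : \sum_i (fhat w (x i) - fstar (x i)) ^+ 2 <=
      2 * \sum_i xi i w * (fhat w (x i) - fstar (x i)).
    apply: (le_trans (least_squares_basic (fmin fstar fsM fsV))).
    rewrite le_eqVlt; apply/orP; left; apply/eqP; congr (_ * _).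
    by apply: eq_bigr => i _; rewrite yE [fstar _ + _]addrC addrK.
  apply: (le_trans (split_noise_le (z w) H)); rewrite lerD2l -!mulrA.
  have := functional w _ fhM fhV; have := functional w _ fsM fsV.
  set S := \sum_(m < L | _) _ => h1 h2.
  have -> : \sum_i (xi i w - z w i) * (fhat w (x i) - fstar (x i)) =
    \sum_i (xi i w - z w i) * fhat w (x i) - \sum_i (xi i w - z w i) * fstar (x i).
    by rewrite -sumrB; apply: eq_bigr => i _; rewrite mulrBr.
  have := ler_normB (\sum_i (xi i w - z w i) * fhat w (x i)) (\sum_i (xi i w - z w i) * fstar (x i)).
  by rewrite [V * S]mulrC; lra.
have meanZ m : mean_le P (Z m) ((2 * d + 4)%:R * (sigma * Num.sqrt (K m)) * Num.sqrt m.+1%:R).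
  have sK0 : 0 < Num.sqrt (K m) by rewrite sqrtr_gt0.
  have sm0 : 0 < Num.sqrt m.+1%:R :> R by rewrite sqrtr_gt0.
  have smE : Num.sqrt m.+1%:R ^+ 2 = m.+1%:R :> R by rewrite sqr_sqrtr.
  have sKE : Num.sqrt (K m) ^+ 2 = K m by rewrite sqr_sqrtr // ltW.
  apply: (@mean_le_weak _ _ _ _ _ ((c m + 1) / l m)).
    rewrite ler_pdivrMr //.
    have -> : (2 * d + 4)%:R * (sigma * Num.sqrt (K m)) * Num.sqrt m.+1%:R * l m
      = (2 * d + 4)%:R * m.+1%:R.
      by rewrite -[in RHS]smE /l; field; rewrite !gt_eqF.
    have -> : (2 * d + 4)%:R = (2 * d + 3)%:R + 1 :> R by rewrite natr1 -addnS.
    by rewrite mulrDl mul1r lerD2l ler1n.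
  have Hs := mean_le_sup (D := Dm m) (v := v) (l := l m) (c := c m) (K := K m)
    indX sg (l0 m) (c0 m).
  apply: Hs.
    move=> a /andP[Da /eqP am]; rewrite (le_trans (contr _)) // /K -am; exact: normB.
  have -> : sigma ^+ 2 * (l m ^+ 2 * K m) / 2 = m.+1%:R / 2.
    by rewrite /l expr_div_n exprMn smE sKE; field; rewrite !gt_eqF.
  have card : #|Dm m|%:R <= 2 ^+ d * m.+1%:R ^+ s.-1 * 2 ^+ m :> R.
    by rewrite -!natrX -!natrM ler_nat; exact: cardJ.
  have e2 : 2 <= expR 1 :> R by have := expR_ge1Dx (1 : R); lra.
  have E1 : 2 * 2 ^+ d * 2 ^+ m <= expR ((d + m).+1%:R) :> R.
    rewrite -exprS -exprD addSn -[X in expR X]mulr1 expRM_natl.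
    by rewrite lerXn2r // ?nnegrE ?expR_ge0.
  have E2 : m.+1%:R ^+ s.-1 <= expR (s.-1%:R * m.+1%:R) :> R.
    rewrite expRM_natl lerXn2r // ?nnegrE ?expR_ge0 //.
    by have := expR_ge1Dx (m.+1%:R : R); lra.
  apply: (@le_trans _ _ ((2 * 2 ^+ d * 2 ^+ m) * m.+1%:R ^+ s.-1 * expR (m.+1%:R / 2))).
    rewrite ler_wpM2r ?expR_ge0 // -mulrA -mulrA ler_wpM2l // (le_trans card) //.
    by rewrite le_eqVlt; apply/orP; left; apply/eqP; ring.
  apply: (@le_trans _ _ (expR ((d + m).+1%:R) * expR (s.-1%:R * m.+1%:R) * expR (m.+1%:R / 2))).
    by rewrite ler_wpM2r ?expR_ge0 // ler_pM ?exprn_ge0 // ?mulr_ge0 ?exprn_ge0.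
  rewrite -!expRD ler_expR /c.
  have k1 : (d + m).+1%:R <= d.+1%:R * m.+1%:R :> R by rewrite -natrM ler_nat succ_add_le_mul.
  have k2 : s.-1%:R * m.+1%:R <= d%:R * m.+1%:R :> R.
    by rewrite ler_wpM2r // ler_nat (leq_trans (leq_pred s)).
  have k3 : (2 * d + 3)%:R = d.+1%:R + d%:R + 2 :> R by rewrite -!natrD mul2n -addnn addSn addn2 addn3.
  have k4 : 0 <= m.+1%:R :> R by [].
  by rewrite k3; lra.
have meanz : mean_le P (fun w => \sum_i z w i ^+ 2)
    (4 * expR (1 / 2) * sigma ^+ 2 * (2 * 2 ^+ d * (2 ^+ M * M.+1%:R ^+ s.-1))).
  apply: mean_le_weak (mean_le_sum _ (fun i _ => mean_le_sqr sigma0 indX sg (p i))).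
  rewrite -mulr_sumr; apply: ler_wpM2l.
    by apply: mulr_ge0; [apply: mulr_ge0 => //; exact: expR_ge0|exact: sqr_ge0].
  apply: (le_trans frob).
  rewrite -!natrX -!natrM ler_nat.
  have -> : #|DM| = (\sum_(m < M.+1) #|Dm m|)%N.
    rewrite -sum1_card (partition_big (fun j => inord (lev j) : 'I_M.+1) xpredT) //=.
    apply: eq_bigr => m _; rewrite -sum1_card; apply: eq_bigl => j; rewrite !inE -andbA.
    case: (D j) => //=; rewrite -val_eqE /=; case: leqP => jM /=; first by rewrite inordK.
    by apply/esym/eqP => jm; move: jM; rewrite jm ltnNge -ltnS ltn_ord.
  rewrite (leq_trans (leq_sum _ (fun m _ => cardJ (nat_of_ord m)))) //.
  under eq_bigr do rewrite -mulnA.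
  rewrite -big_distrr /=.
  apply: (@leq_trans (2 ^ d * (M.+1 ^ s.-1 * 2 ^ M.+1))%N).
    by rewrite leq_mul2l level_head_le orbT.
  by apply/eq_leq; rewrite expnS; ring.
have meanG : mean_le P G (4 * (4 * expR (1 / 2) * sigma ^+ 2 * (2 * 2 ^+ d * (2 ^+ M * M.+1%:R ^+ s.-1))) +
   8 * V * \sum_(m < L | (M < m)%N) W m * ((2 * d + 4)%:R * (sigma * Num.sqrt (K m)) * Num.sqrt m.+1%:R)).
  apply: mean_leD; first exact: mean_leZ.
  apply: mean_leZ; first by rewrite mulr_ge0 ?ltW.
  by apply: mean_le_sum => m _; exact: mean_leZ.
rewrite /risk unlock.
apply: (@integral_le_mean _ _ _ P _ (fun w => n%:R^-1 * G w)).
  move=> w; have /andP[h1 h2] := point w.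
  by rewrite mulr_ge0 ?invr_ge0 ?(ltW n0) //= ler_wpM2l ?invr_ge0 ?(ltW n0).
apply: (mean_le_weak _ (mean_leZ _ meanG)); last by rewrite invr_ge0 ltW.
have tail : \sum_(m < L | (M < m)%N) W m * ((2 * d + 4)%:R * (sigma * Num.sqrt (K m)) * Num.sqrt m.+1%:R)
   <= 4 ^+ d * ((2 * d + 4)%:R * Num.sqrt C0) * ((2 * d ^ d)%:R / (1 - q)) *
      (sigma * Num.sqrt n%:R * (M.+1%:R ^+ s.-1 * Num.sqrt M.+1%:R * q ^+ (3 * M))).
  have KE m : Num.sqrt (K m) = Num.sqrt C0 * Num.sqrt n%:R * q ^+ m.
    rewrite /K sqrtrM ?mulr_ge0 ?(ltW C00) // sqrtrM ?(ltW C00) //; congr (_ * _).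
    by rewrite -exprVn -qq -exprM mulnC exprM sqrtr_sqr ger0_norm // exprn_ge0 // ltW.
  rewrite (eq_bigr (fun m : 'I_L => 4 ^+ d * ((2 * d + 4)%:R * Num.sqrt C0) * (sigma * Num.sqrt n%:R) *
     (m.+1%:R ^+ s.-1 * Num.sqrt m.+1%:R * q ^+ (3 * m)))); last first.
    move=> m _; rewrite KE /W.
    have -> : q ^+ (3 * m) = 2 ^- m * q ^+ m by rewrite -exprVn -qq -exprM -exprD addnC -mulSn.
    ring.
  rewrite -mulr_sumr (le_trans (ler_wpM2l _ (level_tail_le R M L sd))) //.
    by rewrite !mulr_ge0 ?exprn_ge0 ?sqrtr_ge0 ?(ltW sigma0).
  by rewrite le_eqVlt; apply/orP; left; apply/eqP; rewrite -/q; ring.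
move: tail; rewrite -/q.
set S := \sum_(m < L | _) _; set X := 2 ^+ M * _; set Y := _ * q ^+ (3 * M) => tail.
have sn0 : 0 < Num.sqrt n%:R :> R by rewrite sqrtr_gt0.
have snE : Num.sqrt n%:R ^+ 2 = n%:R :> R by rewrite sqr_sqrtr // ltW.
set r := Num.sqrt n%:R in sn0 snE tail *.
have X0 : 0 <= X by rewrite mulr_ge0 ?exprn_ge0.
have Y0 : 0 <= Y by rewrite !mulr_ge0 ?exprn_ge0 ?sqrtr_ge0 ?(ltW q0).
rewrite mulrDr; apply: lerD.
  apply: (@le_trans _ _ (C1 * (sigma ^+ 2 / n%:R) * X)).
    by rewrite le_eqVlt; apply/orP; left; apply/eqP; rewrite /C1; field; rewrite gt_eqF.
  by rewrite !ler_wpM2r ?lerDl ?divr_ge0 ?sqr_ge0 ?(ltW n0).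
apply: (@le_trans _ _ (C2 * (sigma * V / r) * Y)).
  have k0 : 0 <= n%:R^-1 * (8 * V) by rewrite !mulr_ge0 ?invr_ge0 ?(ltW n0) ?(ltW V0).
  rewrite [X in X <= _]mulrA; apply: (le_trans (ler_wpM2l k0 tail)).
  rewrite le_eqVlt; apply/orP; left; apply/eqP; rewrite /C2 -snE; field.
  by rewrite gt_eqF // subr_eq0 gt_eqF.
apply: ler_wpM2r => //; apply: ler_wpM2r; last by rewrite lerDr ltW.
by rewrite divr_ge0 ?mulr_ge0 // ltW.
Qed.

(** * Choice of the cutoff level *)

Section LevelChoice.
Variable R : realType.

Lemma powR_expR (a x : R) : expR a `^ x = expR (x * a).
Proof. by rewrite /powR gt_eqF ?expR_gt0 // expRK. Qed.

Lemma ln2_ge_half : 1 / 2 <= ln 2 :> R.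
Proof.
rewrite -[1 / 2](expRK) ler_ln ?posrE ?expR_gt0 //.
have := expR_ge1Dx (- (1 / 2) : R); rewrite expRN => h.
have p := expR_gt0 (1 / 2 : R); set z := expR _ in h p *.
have zz : z * z^-1 = 1 by rewrite mulfV // gt_eqF.
by nra.
Qed.

(** Both sides are monomials; through logarithms the identity becomes linear in the exponents. *)
Lemma rate_rescale (V sigma m : R) : 0 < V -> 0 < sigma -> 0 < m ->
  (sigma ^+ 2 * V `^ (1 / 2) / m) `^ (4 / 5)
  = sigma ^+ 2 / m * (V * m `^ (1 / 2) / sigma) `^ (2 / 5).
Proof.
move=> V0 s0 m0; rewrite -(lnK V0) -(lnK s0) -(lnK m0).
rewrite !powR_expR -!expRM_natl -!expRN -!expRD !powR_expR -!expRD.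
by congr expR; field.
Qed.

Lemma dyadic_level (t : R) : 1 <= t -> exists M, 2 ^+ M <= t < 2 ^+ M.+1.
Proof.
move=> t1; have ex : exists m : nat, t < 2 ^+ m.
  exists (Num.truncn t).+1; rewrite (lt_le_trans (truncnS_gt _)) // -natrX ler_nat.
  by rewrite ltnW // ltn_expl.
case: (ex_minnP ex) => -[|M] h1 h2; first by move: h1; rewrite expr0 ltNge t1.
exists M; rewrite h1 andbT leNgt; apply/negP => /h2; by rewrite ltnn.
Qed.

Lemma level_choice (d s n : nat) (T : R) : 0 < T -> (1 <= s <= d)%N -> (1 < n)%N ->
  exists M : nat,
  2 ^+ M * M.+1%:R ^+ s.-1
  + T * (M.+1%:R ^+ s.-1 * Num.sqrt M.+1%:R * Num.sqrt 2^-1 ^+ (3 * M))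
  <= 4 * 9 ^+ d * (T `^ (2 / 5) * ln (2 + T) `^ (3 * (2 * s%:R - 1) / 5) + ln n%:R ^+ 2).
Proof.
move=> T0 /andP[s1 sd] n1; set e : R := 3 * (2 * s%:R - 1) / 5; set t := T `^ (2 / 5).
set L := ln (2 + T).
have sR : 1 <= s%:R :> R by rewrite ler1n.
have sdR : s%:R <= d%:R :> R by rewrite ler_nat.
have e0 : 0 <= e by rewrite /e; lra.
have e2 : e <= (2 * d)%:R by rewrite natrM /e; lra.
have t0 : 0 < t by rewrite powR_gt0.
have half := ln2_ge_half.
have L2 : 1 / 2 <= L by rewrite (le_trans half) // ler_ln ?posrE; lra.
have n2 : 1 / 4 <= ln n%:R ^+ 2 :> R.
  have : 1 / 2 <= ln n%:R :> R.
    by rewrite (le_trans half) // ler_ln ?posrE ?ltr0n ?(ler_nat R 2) // ltnW.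
  by move=> h; rewrite expr2; nra.
have p9 : 1 <= 9 ^+ d :> R by rewrite exprn_ege1 // (ler_nat R 1 9).
have Le0 : 0 <= t * L `^ e by rewrite mulr_ge0 ?powR_ge0 ?ltW.
have scale (x : R) : 0 <= x -> (x <= 9 ^+ d * L `^ e) -> t * x <= 9 ^+ d * (t * L `^ e).
  by move=> x0 h; rewrite mulrCA ler_wpM2l // ltW.
have [T1|T1] := leP 1 T; last first.
  exists 0%N; rewrite !expr1n muln0 !expr0 sqrtr1 !mulr1.
  have Tt : T <= t.
    by apply: ger1_powR; [rewrite T0 ltW|lra].
  have : t * 1 <= 9 ^+ d * (t * L `^ e).
    apply: scale => //; apply: (@le_trans _ _ (9 ^+ d * (1 / 3) `^ e)).
      apply: (@le_trans _ _ (9 ^+ d * (1 / 3) `^ (2 * d)%:R)); last first.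
        by rewrite ler_wpM2l ?exprn_ge0 //; apply: ger_powR => //; lra.
      rewrite powR_mulrn // exprM -exprMn (_ : 9 * (1 / 3) ^+ 2 = 1) ?expr1n //.
      by field.
    rewrite ler_wpM2l ?exprn_ge0 // ge0_ler_powR ?nnegrE //; lra.
  have : 4 * (9 ^+ d * (1 / 4)) <= 4 * (9 ^+ d * ln n%:R ^+ 2) :> R.
    by apply: ler_wpM2l => //; apply: ler_wpM2l => //; rewrite exprn_ge0.
  by rewrite mulrDr -!mulrA; lra.
have t1 : 1 <= t.
  by rewrite -(powRr0 T) /t ler_powR // ; lra.
have [M /andP[M1 M2]] := dyadic_level t1; exists M.
(* From 2^M <= T^(2/5) and ln 2 >= 1/2, M <= 4 L / 5; moreover 1 <= 2 L. *)
have M3 : M.+1%:R <= 3 * L.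
  have : M%:R * ln 2 <= 2 / 5 * L.
    rewrite mulr_natl -lnXn // (@le_trans _ _ (ln t)) ?ler_ln ?posrE ?exprn_gt0 //.
    by rewrite ln_powR ler_wpM2l // ler_ln ?posrE //; lra.
  rewrite -natr1; have : 0 <= M%:R :> R by []. nra.
have Y1 : 1 <= 3 * L by lra.
have YE : (3 * L) `^ e <= 9 ^+ d * L `^ e.
  rewrite powRM //; [|lra]; rewrite ler_wpM2r ?powR_ge0 //.
  rewrite (le_trans (ler_powR _ e2)) ?(ler_nat R 1 3) // powR_mulrn // exprM.
  by rewrite le_eqVlt; apply/orP; left; apply/eqP; congr (_ ^+ _); rewrite -natrX.
have P1 : M.+1%:R ^+ s.-1 <= (3 * L) `^ e.
  rewrite (@le_trans _ _ ((3 * L) ^+ s.-1)) ?lerXn2r ?nnegrE //; first by lra.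
  rewrite -powR_mulrn; last by lra.
  by rewrite ler_powR // -subn1 natrB // /e; lra.
have P2 : M.+1%:R ^+ s.-1 * Num.sqrt M.+1%:R <= (3 * L) `^ e.
  apply: (@le_trans _ _ ((3 * L) ^+ s.-1 * (3 * L) `^ (1 / 2))).
    rewrite ler_pM ?exprn_ge0 ?sqrtr_ge0 ?lerXn2r ?nnegrE //; first by lra.
    rewrite mul1r powR12_sqrt; last by lra.
    by rewrite ler_wsqrtr.
  rewrite -powR_mulrn; last by lra.
  rewrite -powRD; last by apply/implyP => _; rewrite gt_eqF //; lra.
  by rewrite ler_powR // -subn1 natrB // /e; lra.
(* After squaring, T^2 = t^5 and t < 2 * 2^M give t^5 / 8^M <= 8 t^2, and 8 <= 9. *)
have Q : T * Num.sqrt 2^-1 ^+ (3 * M) <= 3 * t.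
  have tT : t ^+ 5 = T ^+ 2.
    rewrite -powR_mulrn ?(ltW t0) // /t -powRrM (_ : 2 / 5 * 5%:R = 2%:R); last by field.
    by rewrite powR_mulrn // ltW.
  have q0 : 0 <= Num.sqrt 2^-1 :> R by exact: sqrtr_ge0.
  rewrite -(@ler_pXn2r _ 2) ?nnegrE ?mulr_ge0 ?exprn_ge0 ?(ltW T0) ?(ltW t0) //.
  rewrite exprMn -exprM (_ : 3 * M * 2 = 2 * (M * 3))%N; last by ring.
  rewrite exprM sqrt_half_sqr exprM exprVn exprVn -tT.
  have D0 : 0 < 2 ^+ M :> R by rewrite exprn_gt0.
  move: M2; rewrite exprS => M2; set D := 2 ^+ M in D0 M2 *.
  rewrite ler_pdivrMr ?exprn_gt0 //.
  have h3 : t ^+ 3 <= (2 * D) ^+ 3 by rewrite lerXn2r ?nnegrE ?mulr_ge0 ?(ltW t0) ?(ltW D0) // ltW.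
  have h4 := ler_wpM2l (sqr_ge0 t) h3.
  have h5 : 0 <= t ^+ 2 * D ^+ 3 by rewrite mulr_ge0 ?exprn_ge0 // ltW.
  have -> : t ^+ 5 = t ^+ 2 * t ^+ 3 by rewrite -exprD.
  apply: (le_trans h4); rewrite !exprMn; nra.
have Y0 : 0 <= (3 * L) `^ e := powR_ge0 _ _.
have A1 : 2 ^+ M * M.+1%:R ^+ s.-1 <= t * (3 * L) `^ e by rewrite ler_pM ?exprn_ge0.
have A2 : T * (M.+1%:R ^+ s.-1 * Num.sqrt M.+1%:R * Num.sqrt 2^-1 ^+ (3 * M)) <= 3 * t * (3 * L) `^ e.
  rewrite mulrCA [X in X <= _]mulrC; apply: ler_pM => //.
  by rewrite mulr_ge0 ?exprn_ge0 ?sqrtr_ge0 // ltW.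
have := scale _ Y0 YE; have : 0 <= 4 * 9 ^+ d * ln n%:R ^+ 2 :> R.
  by rewrite mulr_ge0 ?sqr_ge0 // mulr_ge0 ?exprn_ge0.
by rewrite [_ * (_ + _)]mulrDr -!mulrA; rewrite -mulrA in A2; lra.
Qed.

End LevelChoice.

Theorem theorem3p1 (R : realType) (rho : R) (d : nat)
    (hrho : 0 < rho) (hd : (1 <= d)%N) :
  exists2 C : R, 0 < C &
  forall (s : nat) (V sigma : R),
    (1 <= s <= d)%N -> 0 < V -> 0 < sigma ->
  forall (n : nat) (N : 'I_d -> nat) (u : 'I_d -> nat -> R)
      (x : 'I_n -> d.-tuple R),
    lattice_design rho N u x ->
  forall (disp : measure_display) (T : measurableType disp)
      (P : probability T R) (xi : 'I_n -> {RV P >-> R})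
      (fstar : d.-tuple R -> R) (y : 'I_n -> T -> R),
    mutually_independent xi ->
    (forall i, ('E_P[xi i] = 0)%E) ->
    (forall i, sub_gaussian sigma (xi i)) ->
    (forall i w, y i w = fstar (x i) + xi i w) ->
    mars_class s fstar ->
    (Vmars s fstar <= V%:E)%E ->
  forall fhat : T -> d.-tuple R -> R,
    (forall w, is_mars_estimator s V x (fun i => y i w) (fhat w)) ->
    (risk P x fhat fstar <=
     (C * (sigma ^+ 2 * (V `^ (1 / 2)) / n%:R) `^ (4 / 5)
        * ln (2 + V * (n%:R `^ (1 / 2)) / sigma)
            `^ (3 * (2 * s%:R - 1) / 5)
      + C * (sigma ^+ 2 / n%:R) * ln n%:R ^+ 2)%:E)%E.
Proof.
have [C C0 bound] := @risk_level_bound R rho d hrho.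
exists (C * (4 * 9 ^+ d)); first by rewrite !mulr_gt0 ?exprn_gt0.
move=> s V sigma sd V0 sigma0 n N u x lat disp T P xi fstar y indX _ sg yE fsM fsV fhat est.
have n1 : (1 < n)%N.
  have N1 k : (1 < N k)%N by case: (lattice_spaced lat k).
  case: (lat) => nE _ _; rewrite [X in (_ < X)%N]nE (bigD1 (Ordinal hd)) //=.
  by rewrite (leq_trans (N1 (Ordinal hd))) // leq_pmulr // prodn_gt0 // => k; rewrite ltnW.
have n0 : 0 < n%:R :> R by rewrite ltr0n ltnW.
set S := V * _ / sigma; have S0 : 0 < S by rewrite divr_gt0 ?mulr_gt0 ?powR_gt0.
have [M MP] := level_choice S0 sd n1.
have := bound s V sigma sd V0 sigma0 n N u x lat disp T P xi fstar y indX sg yE fsM fsV fhat est M.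
move/le_trans; apply; rewrite lee_fin (rate_rescale V0 sigma0 n0) -/S.
(* Both terms of the bound thus carry sigma^2 / n, and [S] is the [T] of [level_choice]. *)
have SE : sigma * V / Num.sqrt n%:R = sigma ^+ 2 / n%:R * S.
  have snE : Num.sqrt n%:R ^+ 2 = n%:R :> R by rewrite sqr_sqrtr // ltW.
  have sn0 : 0 < Num.sqrt n%:R :> R by rewrite sqrtr_gt0.
  rewrite /S mul1r powR12_sqrt; last exact: ltW.
  move: snE sn0; set r := Num.sqrt _ => <- sn0; field.
  by rewrite !gt_eqF.
have a0 : 0 <= C * (sigma ^+ 2 / n%:R) by rewrite mulr_ge0 ?divr_ge0 ?sqr_ge0 // ltW.
have := ler_wpM2l a0 MP; rewrite SE; lra.
Qed.
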